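(* Let $G$ be a pants-like $\mathrm{COL}_2$ group and $\mathcal{C}=\{\mathcal{L}_1,\mathcal{L}_2\}$ a pants-like collection for $G$. If $G$ is Möbius-like, then $G$ is a discrete subgroup of $\mathrm{Homeo}^+(S^1)$ with the compact open topology.
   Context: $S^1$ is the unit circle, oriented counterclockwise. For distinct $u,v\in S^1$, $(u,v)_{S^1}$ is the set of $p$ such that $(u,p,v)$ is counterclockwise ordered (a nondegenerate open interval); the dual of $I=(u,v)_{S^1}$ is $I^*=(v,u)_{S^1}$; $\{I,I^*\}$ lies on $J$ if $I\subseteq J$ or $I^*\subseteq J$. A lamination system is a nonempty family $\mathcal{L}$ of nondegenerate open intervals such that: (1) $I\in\mathcal{L}\Rightarrow I^*\in\mathcal{L}$; (2) for all $I,J\in\mathcal{L}$, $\{I,I^*\}$ lies on $J$ or on $J^*$; (3) if $I_n\in\mathcal{L}$, $I_n\subseteq I_{n+1}$ for all $n$, and $\bigcup_n I_n$ is a nondegenerate open interval, then $\bigcup_n I_n\in\mathcal{L}$. A leaf is $\ell(I)=\{I,I^*\}$ with $I\in\mathcal{L}$. A gap is a subset $\mathscr{G}\subseteq\mathcal{L}$ of pairwise disjoint intervals such that for each $I\in\mathcal{L}$ there is $J\in\mathscr{G}$ on which $\ell(I)$ lies; $v(\mathscr{G})=S^1\setminus\bigcup_{I\in\mathscr{G}}I$. $\mathcal{L}$ is very full if $v(\mathscr{G})$ is finite for every gap. $E(\mathcal{L})=\bigcup_{I\in\mathcal{L}}v(\ell(I))$. For $G<\mathrm{Homeo}^+(S^1)$,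 $\mathcal{L}$ is $G$-invariant if $g(I)\in\mathcal{L}$ for all $g\in G$, $I\in\mathcal{L}$. Two lamination systems are transverse if disjoint as sets. A nontrivial element of $\mathrm{Homeo}^+(S^1)$ is parabolic if it has exactly one fixed point; a cusp point of $G$ is a point fixed by some parabolic element of $G$. A collection $\{\mathcal{L}_\alpha\}$ of $G$-invariant very full lamination systems is pants-like if its members are pairwise transverse and, for $\alpha\ne\beta$, every point of $E(\mathcal{L}_\alpha)\cap E(\mathcal{L}_\beta)$ is a cusp point of $G$. $G$ is pants-like $\mathrm{COL}_n$ if it admits a pants-like collection with $n$ elements. $G$ is Möbius-like if for each $g\in G$ there is $h\in\mathrm{Homeo}^+(S^1)$ with $hgh^{-1}\in\mathrm{PSL}_2(\mathbb{R})$, where $\mathrm{PSL}_2(\mathbb{R})$ acts on $S^1$ as the boundary of the Poincaré disk. *)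

(* Defs.v *)
From HB Require Import structures.
From mathcomp Require Import all_boot all_order all_algebra.
From mathcomp Require Import all_classical all_reals all_analysis.

Set Implicit Arguments.
Unset Strict Implicit.
Unset Printing Implicit Defensive.

Import Order.TTheory GRing.Theory Num.Theory.
Import numFieldNormedType.Exports.

Local Open Scope classical_set_scope.
Local Open Scope ring_scope.

(* [set_type] gives [S1 R] the topology induced from the plane [R * R]. *)
Definition S1 (R : realType) : Type :=
  set_type [set p : R * R | p.1 ^+ 2 + p.2 ^+ 2 = 1].
HB.instance Definition _ (R : realType) := Topological.on (S1 R).

Definition ccw (R : realType) (a b c : S1 R) : Prop :=
  exists t s1 s2 : R,
    [/\ 0 < s1, s1 < s2 & s2 < 2 * pi] /\
    [/\ set_val a = (cos t, sin t),
        set_val b = (cos (t + s1), sin (t + s1)) &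
        set_val c = (cos (t + s2), sin (t + s2))].

Definition arc (R : realType) (u v : S1 R) : set (S1 R) :=
  [set p | ccw u p v].

Definition open_interval (R : realType) (I : set (S1 R)) : Prop :=
  exists u v : S1 R, u <> v /\ I = arc u v.

(* An open interval determines its ordered pair of endpoints, so that
   [dual (arc u v) = arc v u] for [u <> v]; on other sets [dual] is empty. *)
Definition dual (R : realType) (I : set (S1 R)) : set (S1 R) :=
  [set p | exists u v : S1 R, [/\ u <> v, I = arc u v & arc v u p]].

Definition leaf (R : realType) (I : set (S1 R)) : set (set (S1 R)) :=
  [set I; dual I].

Definition lies_on (R : realType) (l : set (set (S1 R))) (J : set (S1 R)) :
  Prop := exists2 K, l K & K `<=` J.

Definition lamination_system (R : realType) (L : set (set (S1 R))) : Prop :=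
  [/\ L !=set0,
      L `<=` @open_interval R,
      (forall I, L I -> L (dual I)),
      (forall I J, L I -> L J ->
         lies_on (leaf I) J \/ lies_on (leaf I) (dual J)) &
      (forall I_ : nat -> set (S1 R),
         (forall n, L (I_ n)) -> (forall n, I_ n `<=` I_ n.+1) ->
         open_interval (\bigcup_n I_ n) -> L (\bigcup_n I_ n))].

Definition gap (R : realType) (L Gp : set (set (S1 R))) : Prop :=
  [/\ Gp `<=` L,
      trivIset Gp id &
      (forall I, L I -> exists2 J, Gp J & lies_on (leaf I) J)].

Definition vertices (R : realType) (Gp : set (set (S1 R))) : set (S1 R) :=
  ~` \bigcup_(I in Gp) I.

Definition very_full (R : realType) (L : set (set (S1 R))) : Prop :=
  forall Gp, gap L Gp -> finite_set (vertices Gp).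

Definition endpoints (R : realType) (L : set (set (S1 R))) : set (S1 R) :=
  \bigcup_(I in L) vertices (leaf I).

Definition homeo_plus (R : realType) : set (S1 R -> S1 R) :=
  [set f | [/\ continuous f,
               (exists g : S1 R -> S1 R,
                  [/\ continuous g, cancel f g & cancel g f]) &
               (forall a b c, ccw a b c -> ccw (f a) (f b) (f c))]].

Definition homeo_subgroup (R : realType) (G : set (S1 R -> S1 R)) : Prop :=
  [/\ G `<=` @homeo_plus R,
      G id,
      (forall f g, G f -> G g -> G (f \o g)) &
      (forall f g, G f -> cancel f g -> cancel g f -> G g)].

Definition invariant_system (R : realType) (G : set (S1 R -> S1 R))
    (L : set (set (S1 R))) : Prop :=
  forall g I, G g -> L I -> L (g @` I).

Definition transverse (R : realType) (L M : set (set (S1 R))) : Prop :=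
  L `&` M = set0.

Definition parabolic (R : realType) (g : S1 R -> S1 R) : Prop :=
  [/\ homeo_plus g, g <> id & exists! x, g x = x].

Definition cusp_point (R : realType) (G : set (S1 R -> S1 R)) (x : S1 R) :
  Prop := exists g, [/\ G g, parabolic g & g x = x].

Definition pants_like (R : realType) (G : set (S1 R -> S1 R))
    (C : set (set (set (S1 R)))) : Prop :=
  [/\ (forall L, C L ->
         [/\ lamination_system L, invariant_system G L & very_full L]),
      (forall L M, C L -> C M -> L <> M -> transverse L M) &
      (forall L M, C L -> C M -> L <> M ->
         endpoints L `&` endpoints M `<=` cusp_point G)].

Definition pants_like_COL (R : realType) (n : nat)
    (G : set (S1 R -> S1 R)) : Prop :=
  homeo_subgroup G /\ exists C, pants_like G C /\ (C #= `I_n)%card.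

(* Image of [x : y] in P^1(R) under the Cayley transform
   z |-> (z - i) / (z + i), which maps the upper half-plane onto the Poincare
   disk: (x - iy) / (x + iy) = (x - iy)^2 / (x^2 + y^2). *)
Definition cayley (R : realType) (v : 'cV[R]_2) : R * R :=
  let x := v 0 0 in let y := v 1 0 in
  ((x ^+ 2 - y ^+ 2) / (x ^+ 2 + y ^+ 2),
   - (2 * x * y) / (x ^+ 2 + y ^+ 2)).

(* The circle maps induced by SL_2(R), acting on P^1(R) by fractional linear
   transformations and transported by the Cayley transform. *)
Definition PSL2 (R : realType) : set (S1 R -> S1 R) :=
  [set f | exists2 A : 'M[R]_2, \det A = 1 &
     forall (v : 'cV[R]_2) (z : S1 R), v != 0 ->
       set_val z = cayley v -> set_val (f z) = cayley (A *m v)].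

Definition mobius_like (R : realType) (G : set (S1 R -> S1 R)) : Prop :=
  forall g, G g -> exists h hinv : S1 R -> S1 R,
    [/\ homeo_plus h, cancel h hinv, cancel hinv h &
        PSL2 (h \o g \o hinv)].

Definition discrete_subgroup (R : realType) (G : set (S1 R -> S1 R)) : Prop :=
  homeo_subgroup G /\
  forall g, G g -> isolated (G : set {compact-open, S1 R -> S1 R}) g.

(* Main.v *)
(* If one of the two systems has a gap with at least three sides, an element of G
   close to the identity maps the gap to itself side by side, hence fixes at least
   three points and is trivial by the Moebius-like hypothesis. Otherwise very
   fullness forces every interval of both systems to be an increasing limit of
   strictly smaller ones. Then all but finitely many points of the circle are
   endpoints of both systems, so there is a common endpoint p, which is a cusp. The
   dynamics of a parabolic element fixing p spreads one leaf ending at p to all the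
   leaves from p to another point of the circle, in both systems; this contradicts
   transversality. *)
Require Import Defs.
From HB Require Import structures.
From mathcomp Require Import all_boot all_order all_algebra.
From mathcomp Require Import all_classical all_reals all_analysis.
From mathcomp Require Import ring lra.
Import Defs.
Import Order.TTheory GRing.Theory Num.Theory numFieldNormedType.Exports.
Local Open Scope classical_set_scope.
Local Open Scope ring_scope.

Set Implicit Arguments.
Unset Strict Implicit.
Unset Printing Implicit Defensive.

(** * Angular coordinates on the circle *)

(** The only completeness at hand is closure under increasing sequences whose union is again a
    nondegenerate interval. Extremal leaves are therefore built from sequences, and two distinct
    points are kept outside all the intervals so that the union cannot grow to the circle minus a
    point. When every interval is a limit, maximality defeats itself: if the dual of a maximal [K]
    contains two given points, a smaller leaf interval inside [dual K] still contains both, and its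
    dual is strictly larger than [K]. This contradiction produces both the abundance of endpoints
    and the leaves fanning out of a cusp. In the case of a gap, isolation has to be shown at every
    [f] of the group. Prescribing the rough position of the images of three points in each of three
    sides controls f^-1 h together with its inverse, and the inverse is what turns inclusions of
    sides into equalities. Three fixed points suffice because the fixed points of a matrix on the
    projective line are the zeros of a binary quadratic form. *)

Lemma cos_eq1 (R : realType) (d : R) :
  - (2 * pi) < d < 2 * pi -> cos d = 1 -> d = 0.
Proof.
have sin_gt0 (e : R) : 0 < e < 2 * pi -> cos e = 1 -> False.
  move=> /andP[e0 e1] ce.
  have : 0 < sin (e / 2) by apply: sin_gt0_pi; apply/andP; split; lra.
  have ee : e = (e / 2) *+ 2 by rewrite -[_ *+ 2]mulr_natr divfK.
  move: ce; rewrite {1}ee cos_mulr2n cos2sin2 => ce sp.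
  have : 0 < sin (e / 2) ^+ 2 by rewrite exprn_gt0.
  by move: ce; lra.
move=> /andP[d1 d2] cd; case: (ltgtP d 0) => // d0; exfalso.
- by apply: (sin_gt0 (- d)); [apply/andP; split; lra|rewrite cosN].
- by apply: (sin_gt0 d) => //; apply/andP; split.
Qed.

Lemma cos_sin_inj (R : realType) (s t : R) :
  - (2 * pi) < s - t < 2 * pi -> cos s = cos t -> sin s = sin t -> s = t.
Proof.
move=> st cs sn; apply/eqP; rewrite -subr_eq0; apply/eqP/cos_eq1 => //.
by rewrite cosB cs sn -!expr2 cos2Dsin2.
Qed.

Lemma cosD2pi_mul (R : realType) (t : R) : cos (t + 2 * pi) = cos t.
Proof. by rewrite mulr_natl cosD2pi. Qed.

Lemma sinD2pi_mul (R : realType) (t : R) : sin (t + 2 * pi) = sin t.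
Proof. by rewrite mulr_natl sinD2pi. Qed.

Lemma cosB2pi (R : realType) (t : R) : cos (t - 2 * pi) = cos t.
Proof. by rewrite -[RHS](congr1 cos (subrK (2 * pi) t)) cosD2pi_mul. Qed.

Lemma sinB2pi (R : realType) (t : R) : sin (t - 2 * pi) = sin t.
Proof. by rewrite -[RHS](congr1 sin (subrK (2 * pi) t)) sinD2pi_mul. Qed.

Lemma unit_circle_angle (R : realType) (x y : R) : x ^+ 2 + y ^+ 2 = 1 ->
  exists t, [/\ 0 <= t, t < 2 * pi, x = cos t & y = sin t].
Proof.
move=> xy; have x1 : -1 <= x <= 1 by apply/andP; split; nra.
have pp := pi_gt0 R.
have yE : `|y| = sin (acos x).
  by rewrite sin_acos // -xy [_ + y ^+ 2]addrC addrK sqrtr_sqr.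
have cx : cos (acos x) = x by rewrite acosK // in_itv.
have [y0|y0] := leP 0 y.
- exists (acos x); split => //.
  + exact: acos_ge0.
  + by rewrite (le_lt_trans (acos_lepi x1)) //; lra.
  + by rewrite -yE ger0_norm.
- have ax : 0 < acos x.
    rewrite lt_neqAle acos_ge0 // andbT; apply/eqP => a0.
    by move: yE y0; rewrite -a0 sin0 => /eqP; rewrite normr_eq0 => /eqP ->; rewrite ltxx.
  exists (2 * pi - acos x); split.
  + by have := acos_lepi x1; lra.
  + by lra.
  + by rewrite addrC cosD2pi_mul cosN.
  + by rewrite addrC sinD2pi_mul sinN -yE ltr0_norm ?opprK.
Qed.

Lemma S1_angle (R : realType) (p : S1 R) :
  exists t, [/\ 0 <= t, t < 2 * pi & set_val p = (cos t, sin t)].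
Proof.
have [t [t0 t1 ct st]] := unit_circle_angle (set_valP p).
by exists t; split=> //; rewrite [LHS]surjective_pairing ct st.
Qed.

Definition arg (R : realType) (p : S1 R) : R := sval (cid (S1_angle p)).

Definition cis (R : realType) (t : R) : S1 R :=
  exist _ (cos t, sin t) (mem_set (cos2Dsin2 t)).

Lemma argP (R : realType) (p : S1 R) :
  [/\ 0 <= arg p, arg p < 2 * pi & set_val p = (cos (arg p), sin (arg p))].
Proof. exact: svalP (cid (S1_angle p)). Qed.

Lemma arg_cis (R : realType) (t : R) : 0 <= t < 2 * pi -> arg (cis t) = t.
Proof.
move=> /andP[t0 t1]; have [a0 a1 [ca sa]] := argP (cis t).
by apply: cos_sin_inj => //; apply/andP; split; lra.
Qed.

Lemma arg_inj (R : realType) : injective (@arg R).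
Proof.
move=> p q pq; have [_ _ vp] := argP p; have [_ _ vq] := argP q.
by apply: val_inj; move: vp; rewrite pq -vq.
Qed.

Definition cyclic (R : realType) (x y z : R) : Prop :=
  [\/ x < y /\ y < z, y < z /\ z < x | z < x /\ x < y].

Lemma ccw_arg (R : realType) (x y z : S1 R) :
  ccw x y z <-> cyclic (arg x) (arg y) (arg z).
Proof.
have pp := pi_gt0 R.
have [x0 x1 vx] := argP x; have [y0 y1 vy] := argP y.
have [z0 z1 vz] := argP z; split.
- move=> [t [s1 [s2 [[s10 s12 s2p] [tx ty tz]]]]].
  have [cx sx] : cos (arg x) = cos t /\ sin (arg x) = sin t.
    by move: tx; rewrite vx => -[].
  have shift w s : 0 < s < 2 * pi ->
    set_val w = (cos (t + s), sin (t + s)) ->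
    arg w = arg x + s \/ arg w = arg x + s - 2 * pi.
    move=> /andP[s0 sp]; have [w0 w1 ->] := argP w; move=> [cw sw].
    have [h|h] := ltP (arg x + s) (2 * pi).
      left; apply: cos_sin_inj; first by apply/andP; split; lra.
      - by rewrite cw !cosD cx sx.
      - by rewrite sw !sinD cx sx.
    right; apply: cos_sin_inj; first by apply/andP; split; lra.
    - by rewrite cosB2pi cw !cosD cx sx.
    - by rewrite sinB2pi sw !sinD cx sx.
  have [ey|ey] := shift y s1 ltac:(lra) ty;
  have [ez|ez] := shift z s2 ltac:(lra) tz; rewrite ey ez.
  + by constructor 1; split; lra.
  + by constructor 3; split; lra.
  + by exfalso; lra.
  + by constructor 2; split; lra.
- case=> -[h1 h2].
  + exists (arg x), (arg y - arg x), (arg z - arg x).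
    have ey : arg x + (arg y - arg x) = arg y by lra.
    have ez : arg x + (arg z - arg x) = arg z by lra.
    by rewrite ey ez; split; split=> //; lra.
  + exists (arg x), (arg y - arg x + 2 * pi), (arg z - arg x + 2 * pi).
    have ey : arg x + (arg y - arg x + 2 * pi) = arg y + 2 * pi by lra.
    have ez : arg x + (arg z - arg x + 2 * pi) = arg z + 2 * pi by lra.
    by rewrite ey ez !cosD2pi_mul !sinD2pi_mul; split; split=> //; lra.
  + exists (arg x), (arg y - arg x), (arg z - arg x + 2 * pi).
    have ey : arg x + (arg y - arg x) = arg y by lra.
    have ez : arg x + (arg z - arg x + 2 * pi) = arg z + 2 * pi by lra.
    by rewrite ey ez cosD2pi_mul sinD2pi_mul; split; split=> //; lra.
Qed.

(** Counterclockwise distance from [o] to [x], in [0, 2 pi): the coordinate on the circle cut open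
    at [o]. *)
Definition angle (R : realType) (o x : S1 R) : R :=
  if arg o <= arg x then arg x - arg o else arg x - arg o + 2 * pi.

Definition at_angle (R : realType) (o : S1 R) (t : R) : S1 R :=
  if arg o + t < 2 * pi then cis (arg o + t) else cis (arg o + t - 2 * pi).

Lemma angle_ge0 (R : realType) (o x : S1 R) : 0 <= angle o x.
Proof.
have [x0 x1 _] := argP x; have [b0 b1 _] := argP o.
by rewrite /angle; case: (leP (arg o) (arg x)) => ?; lra.
Qed.

Lemma angle_lt2pi (R : realType) (o x : S1 R) : angle o x < 2 * pi.
Proof.
have [x0 x1 _] := argP x; have [b0 b1 _] := argP o.
by rewrite /angle; case: (leP (arg o) (arg x)) => ?; lra.
Qed.

Lemma angle_self (R : realType) (o : S1 R) : angle o o = 0.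
Proof. by rewrite /angle lexx subrr. Qed.

Lemma angle_inj (R : realType) (o : S1 R) : injective (angle o).
Proof.
move=> x y; have [x0 x1 _] := argP x; have [y0 y1 _] := argP y.
have [b0 b1 _] := argP o; move=> xy; apply: arg_inj.
by move: xy; rewrite /angle; case: (leP (arg o) (arg x)) => ?;
  case: (leP (arg o) (arg y)) => ?; lra.
Qed.

Lemma angle_at (R : realType) (o : S1 R) (t : R) :
  0 <= t < 2 * pi -> angle o (at_angle o t) = t.
Proof.
move=> /andP[t0 t1]; have [b0 b1 _] := argP o; rewrite /at_angle /angle.
by case: ltP => h; (rewrite arg_cis; last by apply/andP; split; lra); case: leP => ?; lra.
Qed.

(** Moving the cut only rotates the order, so the base is free. Later arguments take as base one of
    the points involved, whose angle is 0, and become linear arithmetic. *)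
Lemma ccw_angle (R : realType) (o x y z : S1 R) :
  ccw x y z <-> cyclic (angle o x) (angle o y) (angle o z).
Proof.
have [x0 x1 _] := argP x; have [y0 y1 _] := argP y; have [z0 z1 _] := argP z.
have [b0 b1 _] := argP o.
rewrite ccw_arg /cyclic /angle.
case: (leP (arg o) (arg x)) => ?; case: (leP (arg o) (arg y)) => ?;
case: (leP (arg o) (arg z)) => ?; split; case=> -[? ?]; try lra;
first [by constructor 1; split; lra | by constructor 2; split; lra
      | by constructor 3; split; lra].
Qed.

Lemma angle_gt0 (R : realType) (o x : S1 R) : x <> o -> 0 < angle o x.
Proof.
move=> xo; rewrite lt_neqAle angle_ge0 andbT; apply/eqP => a0.
by apply: xo; apply: (@angle_inj R o); rewrite angle_self.
Qed.

Lemma ccw_base (R : realType) (o x y : S1 R) :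
  ccw o x y <-> 0 < angle o x /\ angle o x < angle o y.
Proof.
rewrite (ccw_angle o) angle_self /cyclic.
have := angle_ge0 o x; have := angle_ge0 o y; move=> ? ?; split; last by constructor 1.
by case=> -[? ?]; lra.
Qed.

(* [lra] fails on hypotheses about equality of points. *)
Ltac order :=
  repeat match goal with
  | H : @eq (S1 _) _ _ |- _ => clear H
  | H : @eq (set _) _ _ |- _ => clear H
  | H : not _ |- _ => clear H
  end; lra.

(** * Cyclic order and arcs *)

Lemma ccw_rot (R : realType) (x y z : S1 R) : ccw x y z -> ccw y z x.
Proof. by rewrite !ccw_arg; case=> ?; [constructor 3|constructor 1|constructor 2]. Qed.

Lemma ccw_asym (R : realType) (x y z : S1 R) : ccw x y z -> ~ ccw x z y.
Proof. by rewrite !ccw_arg; case=> -[? ?] [] [? ?]; order. Qed.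

Lemma ccw_neq (R : realType) (x y z : S1 R) :
  ccw x y z -> [/\ x <> y, y <> z & x <> z].
Proof.
by rewrite !ccw_arg => -[] [? ?]; split=> /(congr1 (@arg R)) ?; order.
Qed.

Lemma ccw_total (R : realType) (x y z : S1 R) :
  x <> y -> y <> z -> x <> z -> ccw x y z \/ ccw x z y.
Proof.
move=> xy yz xz; rewrite !(ccw_base x).
have := angle_gt0 (fun e => xy (esym e)); have := angle_gt0 (fun e => xz (esym e)).
move=> ? ?; case: (ltgtP (angle x y) (angle x z)) => h; [by left|by right|].
by case: yz; apply: (@angle_inj _ x).
Qed.

Lemma ccw_trans (R : realType) (a b c d : S1 R) :
  ccw a b c -> ccw a c d -> ccw a b d.
Proof. by rewrite !ccw_base => -[? ?] [? ?]; split; order. Qed.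

Lemma ccw_between (R : realType) (o : S1 R) (s t : R) :
  0 <= s -> s < t -> t <= 2 * pi -> exists p, s < angle o p < t.
Proof.
move=> s0 st t2; exists (at_angle o ((s + t) / 2)).
by rewrite angle_at; apply/andP; split; order.
Qed.

Lemma arc_nonempty (R : realType) (u v : S1 R) : u <> v -> arc u v !=set0.
Proof.
move=> uv; have v0 := angle_gt0 (fun e => uv (esym e)).
have v2 := angle_lt2pi u v.
have [p /andP[? ?]] := @ccw_between _ u 0 _ (lexx 0) v0 (ltW v2).
by exists p; apply/ccw_base.
Qed.

(** Points just after [u], before both [v] and [u'], lie in [arc u' v']. If [u] differed from [u'],
    the left end would not separate them from [u], which would then lie in that arc. *)
Lemma arc_left (R : realType) (u v u' v' : S1 R) : u <> v ->
  arc u v `<=` arc u' v' -> ~ arc u' v' u -> u = u'.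
Proof.
move=> uv sub nu; case: (pselect (u = u')) => // uu'; exfalso.
have v0 := angle_gt0 (fun e => uv (esym e)).
have u'0 := angle_gt0 (fun e => uu' (esym e)).
have v2 := angle_lt2pi u v; have u2 := angle_lt2pi u u'.
have := angle_ge0 u v' => v'0.
have [p /andP[p0 pm]] : exists p, 0 < angle u p < Num.min (angle u v) (angle u u').
  by apply: ccw_between; rewrite // ?lt_min ?v0 ?u'0 // ge_min (ltW v2).
move: pm; rewrite lt_min => /andP[pv pu'].
have : arc u' v' p by apply: sub; apply/ccw_base.
rewrite /arc /= (ccw_angle u) => -[] [? ?]; try order.
apply: nu; rewrite /arc /= (ccw_angle u) angle_self.
have [v'e|v'n] := pselect (angle u v' = 0); first by order.
have : 0 < angle u v' by rewrite lt_neqAle v'0 andbT eq_sym; apply/eqP.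
by move=> ?; constructor 2; split; order.
Qed.

Lemma arc_right (R : realType) (u v u' v' : S1 R) : u <> v ->
  arc u v `<=` arc u' v' -> ~ arc u' v' v -> v = v'.
Proof.
move=> uv sub nv; case: (pselect (v = v')) => // vv'; exfalso.
have u0 := angle_gt0 uv.
have v'0 := angle_gt0 (fun e => vv' (esym e)).
have u2 := angle_lt2pi v u; have v2 := angle_lt2pi v v'.
have := angle_ge0 v u' => u'0; have := angle_lt2pi v u' => u'2.
have [p /andP[pm p2]] : exists p, Num.max (angle v u) (angle v v') < angle v p < 2 * pi.
  by apply: ccw_between; rewrite // ?gt_max ?u2 ?v2 // le_max (ltW u0).
move: pm; rewrite gt_max => /andP[pu pv'].
have : arc u' v' p.
  by apply: sub; rewrite /arc /= (ccw_angle v) angle_self; constructor 3; split; order.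
rewrite /arc /= (ccw_angle v) => -[] [? ?]; try order.
by apply: nv; rewrite /arc /= (ccw_angle v) angle_self; constructor 2; split; order.
Qed.

Lemma arcN_left (R : realType) (u v : S1 R) : ~ arc u v u.
Proof. by case/ccw_neq. Qed.

Lemma arcN_right (R : realType) (u v : S1 R) : ~ arc u v v.
Proof. by case/ccw_neq. Qed.

Lemma arc_inj (R : realType) (u v u' v' : S1 R) : u <> v ->
  arc u v = arc u' v' -> u = u' /\ v = v'.
Proof.
move=> uv e; split.
- by apply: (@arc_left _ _ v _ v') => //; rewrite -e //; exact: arcN_left.
- by apply: (@arc_right _ u _ u') => //; rewrite -e //; exact: arcN_right.
Qed.

Lemma dual_arc (R : realType) (u v : S1 R) : u <> v -> dual (arc u v) = arc v u.
Proof.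
move=> uv; apply/seteqP; split=> [p [u' [v' [_ e pv]]]|p pv]; last by exists u, v.
by have [-> ->] := arc_inj uv e.
Qed.

Lemma open_interval_dual (R : realType) (I : set (S1 R)) :
  open_interval I -> open_interval (dual I).
Proof.
by move=> [u [v [uv ->]]]; exists v, u; split; [exact: nesym|exact: dual_arc].
Qed.

Lemma dualK (R : realType) (I : set (S1 R)) :
  open_interval I -> dual (dual I) = I.
Proof. by move=> [u [v [uv ->]]]; rewrite !dual_arc //; exact: nesym. Qed.

Lemma arc_cover (R : realType) (u v x : S1 R) : u <> v ->
  [\/ x = u, x = v, arc u v x | arc v u x].
Proof.
move=> uv; case: (pselect (x = u)) => [|xu]; first by constructor 1.
case: (pselect (x = v)) => [|xv]; first by constructor 2.
have [h|h] := ccw_total (nesym xu) xv uv; first by constructor 3.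
by constructor 4; apply: ccw_rot.
Qed.

Lemma arc_dual_disj (R : realType) (u v x : S1 R) : arc u v x -> ~ arc v u x.
Proof. by move=> /ccw_asym h /ccw_rot/ccw_rot /h. Qed.

Lemma dual_disj (R : realType) (I : set (S1 R)) x : I x -> ~ dual I x.
Proof. by move=> Ix [u [v [uv e vux]]]; move: Ix; rewrite e => /arc_dual_disj. Qed.

(** Openness of arcs in terms of the order alone: there is room on both sides of [p], and [m] bounds
    how far [y] and [z] may stray from [p]. *)
Lemma arc_near (R : realType) (u v p m : S1 R) : arc u v p -> m <> p ->
  exists y z, [/\ arc u v y, ccw p y m, arc u v z & ccw m z p].
Proof.
move=> uvp mp; have [up pv uv] := ccw_neq uvp.
have m0 := angle_gt0 mp; have u0 := angle_gt0 up; have v0 := angle_gt0 (nesym pv).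
have m2 := angle_lt2pi p m; have u2 := angle_lt2pi p u; have v2 := angle_lt2pi p v.
have vu : angle p v < angle p u.
  by move: uvp; rewrite /arc /= (ccw_angle p) angle_self => -[] [? ?]; order.
have [y /andP[y0 ym]] : exists y, 0 < angle p y < Num.min (angle p v) (angle p m).
  by apply: ccw_between; rewrite // ?lt_min ?v0 ?m0 // ge_min (ltW v2).
have [z /andP[zm z2]] : exists z, Num.max (angle p u) (angle p m) < angle p z < 2 * pi.
  by apply: ccw_between; rewrite // ?gt_max ?u2 ?m2 // le_max (ltW u0).
move: ym zm; rewrite lt_min gt_max => /andP[yv ym] /andP[zu zm].
exists y, z; split; rewrite /arc /= (ccw_angle p) ?angle_self.
- by constructor 2; split; order.
- by constructor 1; split; order.
- by constructor 3; split; order.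
- by constructor 3; split; order.
Qed.

(** The dual is not the complement, so the ends of [I] need care: an end of [I] outside [J] is an
    end of [J] too, hence outside [dual J]. *)
Lemma dual_subset (R : realType) (I J : set (S1 R)) :
  open_interval I -> open_interval J -> I `<=` J -> dual J `<=` dual I.
Proof.
move=> [u [v [uv ->]]] [a [b [ab ->]]]; rewrite !dual_arc // => sub x bax.
have xo : ~ arc a b x by move=> /arc_dual_disj.
have [xu|xv|/sub//|//] := arc_cover x uv; exfalso.
- by have e := arc_left uv sub; rewrite -xu in e;
  move: bax; rewrite (e xo); exact: arcN_right.
- by have e := arc_right uv sub; rewrite -xv in e;
  move: bax; rewrite (e xo); exact: arcN_left.
Qed.

Lemma infinite_arc (R : realType) (u v : S1 R) : u <> v -> infinite_set (arc u v).
Proof.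
move=> uv; have v0 := angle_gt0 (nesym uv); have v2 := angle_lt2pi u v.
(* Dividing by n + 2 rather than n + 1 keeps the point for n = 0 away from [v]. *)
pose f n := at_angle u (angle u v / n.+2%:R).
have fb n : 0 < angle u v / n.+2%:R < angle u v.
  by rewrite divr_gt0 //= ltr_pdivrMr // ltr_pMr // ltr1n.
have af n : angle u (f n) = angle u v / n.+2%:R.
  by have /andP[f0 fv] := fb n; rewrite angle_at // (ltW f0) (lt_trans fv).
have finj : injective f.
  move=> m n /(congr1 (angle u)); rewrite !af => /(mulfI (lt0r_neq0 v0)).
  by move=> /invr_inj/eqP; rewrite eqr_nat => /eqP[].
move=> fin; apply: infinite_nat.
apply: (sub_finite_set _ (finite_preimage (f := f) _ fin)).
- by move=> n _; rewrite /preimage /= /arc /= ccw_base af; have /andP[] := fb n.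
- by move=> m n _ _ /finj.
Qed.

(** * Openness of arcs through the orientation determinant *)

Lemma set_val_angle (R : realType) (o x : S1 R) :
  set_val x = (cos (arg o + angle o x), sin (arg o + angle o x)).
Proof.
have [_ _ ->] := argP x; rewrite /angle; case: (leP (arg o) (arg x)) => _.
  by rewrite addrC subrK.
by rewrite addrA (addrC (arg o)) subrK cosD2pi_mul sinD2pi_mul.
Qed.

(** Twice the signed area of the triangle [a], [b], [c]. Being polynomial it is continuous, whereas
    [arg] jumps. *)
Definition orient (R : realType) (a b c : R * R) : R :=
  (b.1 - a.1) * (c.2 - a.2) - (b.2 - a.2) * (c.1 - a.1).

(** A triangle inscribed in the unit circle with angles A, B, C has area 2 sin A sin B sin C; here
    the angles are a, b and pi - (a + b). *)
Lemma orient_sin (R : realType) (t a b : R) :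
  orient (cos t, sin t) (cos (t + a *+ 2), sin (t + a *+ 2))
    (cos (t + (a + b) *+ 2), sin (t + (a + b) *+ 2)) =
  4 * (sin a * sin b * sin (a + b)).
Proof.
have c2 (s : R) : cos (s *+ 2) = 1 - 2 * sin s ^+ 2.
  by rewrite cos_mulr2n cos2sin2; ring.
rewrite /orient /= !mulrnDl !(cosD t) !(sinD t).
rewrite (cosD (a *+ 2)) (sinD (a *+ 2)) (sinD a).
set C := cos (a *+ 2); set S := sin (a *+ 2).
transitivity ((cos t ^+ 2 + sin t ^+ 2) * ((C ^+ 2 + S ^+ 2) * sin (b *+ 2)
    + S - (S * cos (b *+ 2) + C * sin (b *+ 2)))); first by ring.
by rewrite /C /S !cos2Dsin2 !c2 !sin_mulr2n; ring.
Qed.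

Lemma ccw_orient (R : realType) (u p v : S1 R) : u <> v ->
  ccw u p v <-> 0 < orient (set_val u) (set_val p) (set_val v).
Proof.
move=> uv; have v0 := angle_gt0 (nesym uv); have v2 := angle_lt2pi u v.
have p0 := angle_ge0 u p; have p2 := angle_lt2pi u p.
rewrite ccw_base (set_val_angle u u) (set_val_angle u p) (set_val_angle u v).
rewrite angle_self addr0.
move: (angle u p) (angle u v) v0 v2 p0 p2 => P V V0 V2 P0 P2.
pose a := P / 2; pose b := (V - P) / 2.
have -> : P = a *+ 2 by rewrite /a; lra.
have -> : V = (a + b) *+ 2 by rewrite /a /b; lra.
rewrite orient_sin pmulr_rgt0 // pmulr_lgt0; last first.
  by apply: sin_gt0_pi; apply/andP; split; rewrite /a /b; lra.
split=> [[h1 h2]|].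
  by rewrite mulr_gt0 //; apply: sin_gt0_pi; apply/andP; split;
    rewrite /a /b in h1 h2 *; lra.
have [a0|aN] := ltP 0 a; last first.
  have -> : a = 0 by rewrite /a in aN *; lra.
  by rewrite sin0 mul0r ltxx.
rewrite pmulr_rgt0; last by apply: sin_gt0_pi; apply/andP; split; rewrite /a in a0 *; lra.
have [b0|bN] := ltP 0 b; first by move=> _; split; rewrite /a /b in a0 b0 *; lra.
have : 0 <= sin (- b).
  by apply: sin_ge0_pi; apply/andP; split; rewrite /b in bN *; lra.
by rewrite sinN oppr_ge0 leNgt => /negP.
Qed.

Lemma open_arc (R : realType) (u v : S1 R) : open (arc u v).
Proof.
have [->|uv] := pselect (u = v).
  rewrite (_ : arc v v = set0); first exact: open0.
  by apply/seteqP; split=> // x /ccw_neq[].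
rewrite (_ : arc u v = (fun p => orient (set_val u) (set_val p) (set_val v))
    @^-1` [set x | x > 0]); last first.
  by apply/seteqP; split=> p /ccw_orient; apply.
have cont : continuous (fun q => orient (set_val u) q (set_val v)).
  move=> q; rewrite /orient; apply: cvgB; apply: cvgM; try exact: cvg_cst;
    apply: cvgB; try exact: cvg_cst; [exact: cvg_fst|exact: cvg_snd].
have /continuousP/(_ _ (@open_gt R 0)) := cont.
have cv : continuous (set_val : S1 R -> R * R) by exact: initial_continuous.
by move/continuousP: cv; apply.
Qed.

(** * Moebius maps with three fixed points *)

Lemma cayley_surj (R : realType) (z : S1 R) :
  exists2 v : 'cV[R]_2, v != 0 & set_val z = cayley v.
Proof.
have := set_valP z; rewrite /= => zz.
have {zz} : (set_val z).1 ^+ 2 + (set_val z).2 ^+ 2 = 1 by [].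
case: (set_val z) => a b /= ab.
have neq0 (v : 'cV[R]_2) i : v i 0 != 0 -> v != 0.
  by apply: contraNneq => ->; rewrite mxE.
have [aN1|aN1] := eqVneq a (-1).
  have b0 : b = 0 by move: ab; rewrite aN1; nra.
  pose v : 'cV[R]_2 := \col_i (if i == 0 then 0 else 1).
  exists v; first by apply: (@neq0 _ 1); rewrite mxE /= oner_neq0.
  by rewrite /cayley !mxE /= aN1 b0; congr pair; field.
have a1 : 1 + a != 0 by rewrite addrC -[1]opprK subr_eq0.
(* A square root of a + ib up to a real factor: (1 + a + ib)^2 = 2 (1 + a) (a + ib). *)
pose v : 'cV[R]_2 := \col_i (if i == 0 then 1 + a else - b).
exists v; first by apply: (@neq0 _ 0); rewrite mxE /=.
have d : (1 + a) ^+ 2 + (- b) ^+ 2 = 2 * (1 + a) by rewrite -ab; nra.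
rewrite /cayley !mxE /= d; congr pair; last by field.
have -> : (1 + a) ^+ 2 - (- b) ^+ 2 = 2 * (1 + a) * a by nra.
by field.
Qed.

Lemma cayley_cross (R : realType) (v w : 'cV[R]_2) :
  v != 0 -> w != 0 -> cayley v = cayley w <-> v 0 0 * w 1 0 = v 1 0 * w 0 0.
Proof.
have sq (u : 'cV[R]_2) : u != 0 -> u 0 0 ^+ 2 + u 1 0 ^+ 2 != 0.
  move=> /eqP u_neq0; apply/eqP => h; apply: u_neq0.
  apply/matrixP => i j; rewrite mxE (ord1 j).
  have [u0 u1] : u 0 0 = 0 /\ u 1 0 = 0 by split; nra.
  by case: i => -[|[|//]] hi; [rewrite -[RHS]u0|rewrite -[RHS]u1];
    congr (u _ _); apply: val_inj.
move=> /sq + /sq; rewrite /cayley.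
move: (v 0 0) (v 1 0) (w 0 0) (w 1 0) => x y x' y' xy xy'; split=> [[e1 e2]|e].
- move/eqP: e1; rewrite eqr_div // => /eqP e1.
  move/eqP: e2; rewrite eqr_div // => /eqP e2.
  (* With z = x - iy and w = x' - iy', this rests on Re(conj(w^2) (w^2 |z|^2 - z^2 |w|^2)) = 2 |w|^2
     Im(conj(w) z)^2, whose left side vanishes by [e1] and [e2]. *)
  have : 2 * (x' ^+ 2 + y' ^+ 2) * (x * y' - y * x') ^+ 2 = 0.
    transitivity ((x' ^+ 2 - y' ^+ 2) *
        ((x' ^+ 2 - y' ^+ 2) * (x ^+ 2 + y ^+ 2) -
         (x ^+ 2 - y ^+ 2) * (x' ^+ 2 + y' ^+ 2)) +
      2 * x' * y' * (- (2 * x * y) * (x' ^+ 2 + y' ^+ 2) -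
         - (2 * x' * y') * (x ^+ 2 + y ^+ 2))); first by ring.
    by rewrite e1 e2 !subrr !mulr0 addr0.
  move/eqP; rewrite !mulf_eq0 pnatr_eq0 (negbTE xy') /= orbb subr_eq0.
  by move/eqP.
- congr pair; apply/eqP; rewrite eqr_div //; apply/eqP/eqP; rewrite -subr_eq0.
    apply/eqP; transitivity (2 * (x * y' - y * x') * (x * y' + y * x')).
      by ring.
    by rewrite e subrr mulr0 mul0r.
  apply/eqP.
  transitivity (2 * (x * y' - y * x') * (x * x' - y * y')); first by ring.
  by rewrite e subrr mulr0 mul0r.
Qed.

Lemma quadratic_three_roots (R : idomainType) (a b c : R)
    (x1 y1 x2 y2 x3 y3 : R) :
  x1 * y2 != y1 * x2 -> x1 * y3 != y1 * x3 -> x2 * y3 != y2 * x3 ->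
  a * x1 ^+ 2 + b * (x1 * y1) + c * y1 ^+ 2 = 0 ->
  a * x2 ^+ 2 + b * (x2 * y2) + c * y2 ^+ 2 = 0 ->
  a * x3 ^+ 2 + b * (x3 * y3) + c * y3 ^+ 2 = 0 ->
  [/\ a = 0, b = 0 & c = 0].
Proof.
rewrite -(subr_eq0 (x1 * y2)) -(subr_eq0 (x1 * y3)) -(subr_eq0 (x2 * y3)).
move=> d12 d13 d23 q1 q2 q3.
pose D := (x1 * y2 - y1 * x2) * (x1 * y3 - y1 * x3) * (x2 * y3 - y2 * x3).
have D0 : D != 0 by rewrite !mulf_neq0.
set e1 := _ + _ in q1; set e2 := _ + _ in q2; set e3 := _ + _ in q3.
(* Cramer's rule for a homogeneous Vandermonde system *)
have Da : D * a = (x2 * y3 - y2 * x3) * y2 * y3 * e1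
    - (x1 * y3 - y1 * x3) * y1 * y3 * e2 + (x1 * y2 - y1 * x2) * y1 * y2 * e3.
  by rewrite /D /e1 /e2 /e3; ring.
have Db : D * b = - (x2 * y3 - y2 * x3) * (x2 * y3 + y2 * x3) * e1
    + (x1 * y3 - y1 * x3) * (x1 * y3 + y1 * x3) * e2
    - (x1 * y2 - y1 * x2) * (x1 * y2 + y1 * x2) * e3.
  by rewrite /D /e1 /e2 /e3; ring.
have Dc : D * c = (x2 * y3 - y2 * x3) * x2 * x3 * e1
    - (x1 * y3 - y1 * x3) * x1 * x3 * e2 + (x1 * y2 - y1 * x2) * x1 * x2 * e3.
  by rewrite /D /e1 /e2 /e3; ring.
by split; apply: (mulfI D0);
  rewrite mulr0 ?Da ?Db ?Dc q1 q2 q3 !mulr0 ?subr0 addr0 ?subr0.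
Qed.

(** A vector spans a fixed point exactly when it is parallel to its image, that is, when the
    determinant of v and A v vanishes. This is a quadratic form in v; three independent zeros kill
    its coefficients, so A is scalar. *)
Lemma PSL2_three_fixed (R : realType) (f : S1 R -> S1 R) (z1 z2 z3 : S1 R) :
  PSL2 f -> z1 <> z2 -> z1 <> z3 -> z2 <> z3 ->
  f z1 = z1 -> f z2 = z2 -> f z3 = z3 -> f = id.
Proof.
move=> [A detA fA] z12 z13 z23.
have mE (v : 'cV[R]_2) i : (A *m v) i 0 = A i 0 * v 0 0 + A i 1 * v 1 0.
  rewrite mxE !big_ord_recl big_ord0 addr0; congr (_ * _ + A i _ * v _ _);
    exact: val_inj.
have A_neq0 (v : 'cV[R]_2) : v != 0 -> A *m v != 0.
  apply: contra_neq => Av; have Au : A \in unitmx by rewrite unitmxE detA unitr1.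
  by rewrite -[v](mulKmx Au) Av mulmx0.
have fixE (z : S1 R) : f z = z -> forall v, v != 0 -> set_val z = cayley v ->
    A 1 0 * v 0 0 ^+ 2 + (A 1 1 - A 0 0) * (v 0 0 * v 1 0)
      + (- A 0 1) * v 1 0 ^+ 2 = 0.
  move=> fz v v0 zv; have := fA v z v0 zv; rewrite fz zv.
  have Av0 := A_neq0 v v0.
  move/(cayley_cross v0 Av0); rewrite !mE => e.
  transitivity (v 0 0 * (A 1 0 * v 0 0 + A 1 1 * v 1 0) -
    v 1 0 * (A 0 0 * v 0 0 + A 0 1 * v 1 0)); first by ring.
  by rewrite e subrr.
have cross (z z' : S1 R) (v v' : 'cV[R]_2) : z <> z' -> v != 0 -> v' != 0 ->
    set_val z = cayley v -> set_val z' = cayley v' ->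
    v 0 0 * v' 1 0 != v 1 0 * v' 0 0.
  move=> zz' v0 v'0 zv z'v'; apply/eqP => /(cayley_cross v0 v'0) e.
  by apply: zz'; apply: val_inj; move: zv; rewrite e -z'v'.
move=> f1 f2 f3.
have [v1 v10 zv1] := cayley_surj z1; have [v2 v20 zv2] := cayley_surj z2.
have [v3 v30 zv3] := cayley_surj z3.
have [a10 a11 a01] := quadratic_three_roots
  (cross _ _ _ _ z12 v10 v20 zv1 zv2) (cross _ _ _ _ z13 v10 v30 zv1 zv3)
  (cross _ _ _ _ z23 v20 v30 zv2 zv3)
  (fixE _ f1 _ v10 zv1) (fixE _ f2 _ v20 zv2) (fixE _ f3 _ v30 zv3).
apply/funext => z; apply: val_inj; have [v v0 zv] := cayley_surj z.
transitivity (cayley (A *m v)); first exact: fA.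
have Av0 := A_neq0 v v0.
transitivity (cayley v); last by rewrite -zv.
apply/(cayley_cross Av0 v0); rewrite !mE a10.
by move/eqP: a11; rewrite subr_eq0 => /eqP ->; move/eqP: a01;
  rewrite oppr_eq0 => /eqP ->; ring.
Qed.

Lemma mobius_like_three_fixed (R : realType) (G : set (S1 R -> S1 R))
    (g : S1 R -> S1 R) (z1 z2 z3 : S1 R) :
  mobius_like G -> G g -> z1 <> z2 -> z1 <> z3 -> z2 <> z3 ->
  g z1 = z1 -> g z2 = z2 -> g z3 = z3 -> g = id.
Proof.
move=> mG Gg z12 z13 z23 g1 g2 g3.
have [h [h' [_ hK h'K P]]] := mG _ Gg.
have hinj z z' : z <> z' -> h z <> h z' by move=> zz' /(can_inj hK).
have hfix z : g z = z -> (h \o g \o h') (h z) = h z by rewrite /= hK => ->.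
have e := PSL2_three_fixed P (hinj _ _ z12) (hinj _ _ z13) (hinj _ _ z23)
  (hfix _ g1) (hfix _ g2) (hfix _ g3).
apply/funext => z; apply: (can_inj hK).
by have /= := congr1 (fun k => k (h z)) e; rewrite hK.
Qed.

(** * Increasing unions and maximal arcs *)

(* The arcs with [o] outside, described by the linear order [ccw o] that the
   circle cut at [o] carries; increasing unions preserve this description. *)
Definition segment (R : realType) (o : S1 R) (X : set (S1 R)) : Prop :=
  [/\ X !=set0, ~ X o,
      (forall a b x, X a -> X b -> ccw o a x -> ccw o x b -> X x),
      (forall a, X a -> exists2 b, X b & ccw o b a) &
      (forall a, X a -> exists2 b, X b & ccw o a b)].

Definition lo (R : realType) (o : S1 R) (X : set (S1 R)) := inf (angle o @` X).
Definition hi (R : realType) (o : S1 R) (X : set (S1 R)) := sup (angle o @` X).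

Lemma angle_has_inf (R : realType) (o : S1 R) (X : set (S1 R)) :
  X !=set0 -> has_inf (angle o @` X).
Proof.
by move=> [x Xx]; split; [exists (angle o x), x|
  exists 0 => _ [y _ <-]; exact: angle_ge0].
Qed.

Lemma angle_has_sup (R : realType) (o : S1 R) (X : set (S1 R)) :
  X !=set0 -> has_sup (angle o @` X).
Proof.
by move=> [x Xx]; split; [exists (angle o x), x|
  exists (2 * pi) => _ [y _ <-]; exact: ltW (angle_lt2pi _ _)].
Qed.

Lemma lo_le (R : realType) (o : S1 R) (X : set (S1 R)) x :
  X x -> lo o X <= angle o x.
Proof.
by move=> Xx; apply: ge_inf;
  [case: (@angle_has_inf _ o X); first exists x|exists x].
Qed.

Lemma hi_ge (R : realType) (o : S1 R) (X : set (S1 R)) x :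
  X x -> angle o x <= hi o X.
Proof.
by move=> Xx; apply: sup_upper_bound;
  [apply: angle_has_sup; exists x|exists x].
Qed.

Lemma lo_ge0 (R : realType) (o : S1 R) (X : set (S1 R)) :
  X !=set0 -> 0 <= lo o X.
Proof.
move=> [x Xx]; apply: lb_le_inf; first by exists (angle o x), x.
by move=> _ [y _ <-]; exact: angle_ge0.
Qed.

Lemma hi_le2pi (R : realType) (o : S1 R) (X : set (S1 R)) :
  X !=set0 -> hi o X <= 2 * pi.
Proof.
move=> [x Xx]; apply: ge_sup; first by exists (angle o x), x.
by move=> _ [y _ <-]; exact: ltW (angle_lt2pi _ _).
Qed.

Lemma lo_mono (R : realType) (o : S1 R) (X Y : set (S1 R)) :
  X !=set0 -> X `<=` Y -> lo o Y <= lo o X.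
Proof.
move=> [x Xx] XY; apply: lb_le_inf; first by exists (angle o x), x.
by move=> _ [y Xy <-]; apply/lo_le/XY.
Qed.

Lemma hi_mono (R : realType) (o : S1 R) (X Y : set (S1 R)) :
  X !=set0 -> X `<=` Y -> hi o X <= hi o Y.
Proof.
move=> [x Xx] XY; apply: ge_sup; first by exists (angle o x), x.
by move=> _ [y Xy <-]; apply/hi_ge/XY.
Qed.

(** Without extremal elements the bounds are not attained, and convexity fills everything strictly
    between them. *)
Lemma segmentE (R : realType) (o : S1 R) (X : set (S1 R)) :
  segment o X -> forall x, X x <-> lo o X < angle o x < hi o X.
Proof.
move=> [X0 Xo conv left right] x; split=> [Xx|/andP[lx xh]].
- have [b Xb] := left _ Xx; have [c Xc] := right _ Xx.
  rewrite !ccw_base => -[_ xc] [_ bx].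
  by rewrite (le_lt_trans (lo_le o Xb)) // (lt_le_trans xc) ?hi_ge.
- have x0 := le_lt_trans (lo_ge0 o X0) lx.
  have [_ [a Xa <-] ax] : exists2 e, (angle o @` X) e & e < angle o x.
    have [|e Ee el] := inf_adherent _ (angle_has_inf o X0) (eps := angle o x - lo o X).
      by rewrite subr_gt0.
    by exists e => //; rewrite (lt_le_trans el) // addrC subrK.
  have [_ [b Xb <-] xb] : exists2 e, (angle o @` X) e & angle o x < e.
    have [|e Ee el] := sup_adherent _ (angle_has_sup o X0) (eps := hi o X - angle o x).
      by rewrite subr_gt0.
    by exists e => //; rewrite (le_lt_trans _ el) // opprB addrC subrK.
  apply: (conv a b) => //; rewrite ccw_base; split=> //.
  by rewrite angle_gt0 // => ao; apply: Xo; rewrite -ao.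
Qed.

(** The second missing point [o'] excludes the circle minus [o], the only segment that is not a
    nondegenerate interval. *)
Lemma segment_open_interval (R : realType) (o o' : S1 R) (X : set (S1 R)) :
  segment o X -> o' <> o -> ~ X o' -> open_interval X.
Proof.
move=> sX o'o Xo'; have XE := segmentE sX; have [X0 Xo _ _ _] := sX.
have l0 := lo_ge0 o X0; have h2 := hi_le2pi o X0.
have lh : lo o X < hi o X.
  by have [x /XE/andP[? ?]] := X0; order.
have := angle_lt2pi o o'; have := angle_gt0 o'o => o'0 o'2.
have nlh : 0 < lo o X \/ hi o X < 2 * pi.
  have [?|?] := ltP 0 (lo o X); first by left.
  have [?|?] := ltP (hi o X) (2 * pi); first by right.
  by exfalso; apply: Xo'; apply/XE; apply/andP; split; order.
pose u := at_angle o (lo o X).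
have uE : angle o u = lo o X by rewrite angle_at //; apply/andP; split; order.
have [h|h] := ltP (hi o X) (2 * pi).
- pose v := at_angle o (hi o X).
  have vE : angle o v = hi o X by rewrite angle_at //; apply/andP; split; order.
  exists u, v; split; first by move=> /(congr1 (angle o)); rewrite uE vE => ?; order.
  apply/seteqP; split=> x; rewrite XE /arc /= (ccw_angle o) uE vE.
    by move=> /andP[? ?]; constructor 1.
  by case=> -[? ?]; apply/andP; split=> //; order.
(* The supremum 2 pi is not the angle of any point: the right end is [o] itself, whose angle is
   0. *)
- have l1 : 0 < lo o X by case: nlh => // ?; order.
  exists u, o; split.
    by move=> /(congr1 (angle o)); rewrite uE angle_self => ?; order.
  apply/seteqP; split=> x; have := angle_lt2pi o x; have := angle_ge0 o x;
    rewrite XE /arc /= (ccw_angle o) uE angle_self => ? ?.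
    by move=> /andP[? ?]; constructor 3; split; order.
  by case=> -[? ?]; apply/andP; split; order.
Qed.

Lemma open_interval_segment (R : realType) (o : S1 R) (X : set (S1 R)) :
  open_interval X -> ~ X o -> segment o X.
Proof.
move=> [u [v [uv ->]]] no.
have far x : arc u v x -> o <> x by move=> + ox; rewrite -ox => /no.
have := angle_ge0 o u; have := angle_ge0 o v => v0 u0.
have conv x y z : arc u v x -> arc u v y -> ccw o x z -> ccw o z y -> arc u v z.
  move: no; rewrite /arc /= !(ccw_base o) !(ccw_angle o) angle_self.
  move=> no hx hy [? ?] [? ?].
  have {}no : ~ (angle o v < angle o u /\ 0 < angle o v).
    by move=> [? ?]; apply: no; constructor 2.
  have vu : ~ (angle o v < angle o u /\ angle o v != 0).
    by move=> [? v_]; apply: no; split=> //; rewrite lt_neqAle eq_sym v_.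
  have [v_|v_] := eqVneq (angle o v) 0.
    by constructor 3; move: hx hy => [] [? ?] [] [? ?]; split; order.
  have {}v0 : 0 < angle o v by rewrite lt_neqAle eq_sym v_.
  have {}vu : angle o u <= angle o v by rewrite leNgt; apply/negP => ?; exact: no.
  by constructor 1; move: hx hy => [] [? ?] [] [? ?]; split; order.
split=> //; first exact: arc_nonempty.
- move=> a ua; have [y [z [_ _ uz oz]]] := arc_near ua (far _ ua).
  by exists z.
- move=> a ua; have [y [z [uy ay _ _]]] := arc_near ua (far _ ua).
  by exists y => //; apply/ccw_rot/ccw_rot.
Qed.

Lemma segment_bigcup (R : realType) (o : S1 R) (X_ : nat -> set (S1 R)) :
  (forall n, segment o (X_ n)) -> (forall n, X_ n `<=` X_ n.+1) ->
  segment o (\bigcup_n X_ n).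
Proof.
move=> sX inc.
have mono m n : (m <= n)%N -> X_ m `<=` X_ n.
  move=> /subnK <-; elim: (n - m)%N => [//|k IH]; exact: subset_trans IH (inc _).
split.
- by have [[x Xx] _ _ _ _] := sX 0%N; exists x, 0%N.
- by move=> [n _]; have [_ + _ _ _] := sX n.
- move=> a b x [m _ Xa] [n _ Xb] oax oxb; exists (maxn m n) => //.
  have [_ _ conv _ _] := sX (maxn m n); apply: (conv a b) => //.
  + by apply: mono Xa; exact: leq_maxl.
  + by apply: mono Xb; exact: leq_maxr.
- move=> a [n _ Xa]; have [_ _ _ left _] := sX n.
  by have [b Xb ba] := left _ Xa; exists b => //; exists n.
- move=> a [n _ Xa]; have [_ _ _ _ right] := sX n.
  by have [b Xb ba] := right _ Xa; exists b => //; exists n.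
Qed.

(** Discharges the side condition of the closure clause of a lamination system: two points avoided
    by all the intervals suffice. *)
Lemma open_interval_bigcup (R : realType) (o o' : S1 R) (I_ : nat -> set (S1 R)) :
  (forall n, open_interval (I_ n)) -> (forall n, I_ n `<=` I_ n.+1) ->
  o <> o' -> (forall n, ~ I_ n o) -> (forall n, ~ I_ n o') ->
  open_interval (\bigcup_n I_ n).
Proof.
move=> oI inc oo' no no'; apply: (@segment_open_interval _ o o').
- by apply: segment_bigcup => // n; apply: open_interval_segment.
- exact: nesym.
- by move=> [n _ /no'].
Qed.

(* At each step half of the possible growth in size is realised, so the union of
   the sequence cannot be enlarged any more. *)
Lemma maximal_interval (R : realType) (o : S1 R) (F : set (set (S1 R))) I0 :
  (forall I, F I -> segment o I) ->
  (forall I_ : nat -> set (S1 R), (forall n, F (I_ n)) ->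
     (forall n, I_ n `<=` I_ n.+1) -> F (\bigcup_n I_ n)) ->
  F I0 -> exists M, [/\ F M, I0 `<=` M & forall K, F K -> M `<=` K -> K = M].
Proof.
move=> sF cF FI0; pose size I := hi o I - lo o I.
have F0 I : F I -> I !=set0 by move=> /sF[].
have size_mono I J : F I -> I `<=` J -> size I <= size J.
  by move=> /F0 I1 IJ; rewrite /size lerB ?hi_mono ?lo_mono.
have size_le I : F I -> size I <= 2 * pi.
  by move=> /F0 I1; rewrite /size lerBlDr (le_trans (hi_le2pi o I1)) // lerDl lo_ge0.
have step I : exists J, F I -> [/\ F J, I `<=` J &
    forall K, F K -> I `<=` K -> size K - size I <= 2 * (size J - size I)].
  have [FI|] := pselect (F I); last by exists I.
  pose E := size @` [set K | F K /\ I `<=` K].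
  have EI : E (size I) by exists I => //; split.
  have supE : has_sup E.
    by split; [exists (size I)|exists (2 * pi) => _ [K [FK _] <-]; exact: size_le].
  have [m|m] := ltP (size I) (sup E).
    have [|_ [J [FJ IJ] <-] h] := sup_adherent _ supE (eps := (sup E - size I) / 2).
      by order.
    exists J => _; split=> // K FK IK.
    have : size K <= sup E by apply: sup_upper_bound => //; exists K.
    by move: h; order.
  exists I => _; split=> // K FK IK.
  have : size K <= sup E by apply: sup_upper_bound => //; exists K.
  by move: m; order.
have [next nextP] := choice step.
pose I_ n := iter n next I0.
have FI n : F (I_ n) by elim: n => //= n /nextP[].
have inc n : I_ n `<=` I_ n.+1 by have [_ ] := nextP _ (FI n).
exists (\bigcup_n I_ n); split; [exact: cF|by move=> x; exists 0%N|].
move=> K FK MK; set M := \bigcup_n I_ n in MK *.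
have FM : F M by exact: cF.
have IM n : I_ n `<=` M by move=> x; exists n.
have sKM : size K <= size M.
  rewrite leNgt; apply/negP => sMK.
  (* [K] competes at every stage, so every stage gains at least half of the excess of [K] over the
     union; enough such gains exceed the bound 2 pi. *)
  have [d dE] : exists d, d = (size K - size M) / 2 by eexists.
  have d0 : 0 < d by rewrite dE; order.
  have grow n : d *+ n <= size (I_ n) - size I0.
    elim: n => [|n IH]; first by rewrite mulr0n subrr.
    have gn : size K - size (I_ n) <= 2 * (size (I_ n.+1) - size (I_ n)).
      by have [_ _] := nextP _ (FI n); apply => //; exact: subset_trans (IM n) MK.
    have sM := size_mono _ _ (FI n) (IM n); rewrite mulrSr.
    by move: (d *+ n) (size (I_ n.+1)) (size (I_ n)) (size K) (size M) (size I0)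
      sMK dE gn sM IH => *; lra.
  have := archi_boundP (_ : 0 <= 2 * pi / d).
  rewrite divr_ge0 ?(ltW d0) ?mulr_ge0 ?pi_ge0 // => /(_ isT).
  rewrite ltr_pdivrMr // mulr_natl; move: (Num.bound _) => n.
  have := grow n; have := size_le _ (FI n).
  have : 0 <= size I0.
    have [x Ix] := F0 _ FI0; rewrite /size subr_ge0.
    exact: le_trans (lo_le o Ix) (hi_ge o Ix).
  by order.
apply/seteqP; split=> // x; rewrite (segmentE (sF _ FK)) (segmentE (sF _ FM)).
have := lo_mono o (F0 _ FM) MK; have := hi_mono o (F0 _ FM) MK.
move: sKM; rewrite /size => ? ? ? /andP[? ?]; apply/andP; split; order.
Qed.

(** * Lamination systems *)

Lemma open_interval_nonempty (R : realType) (I : set (S1 R)) :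
  open_interval I -> I !=set0.
Proof. by move=> [u [v [uv ->]]]; exact: arc_nonempty. Qed.

(** Only the ends of [I] need care: an end lying in [J] would bring nearby points of [I] into
    [J]. *)
Lemma disjoint_dual (R : realType) (I J : set (S1 R)) :
  open_interval I -> open_interval J -> I `&` J = set0 -> J `<=` dual I.
Proof.
move=> [u [v [uv ->]]] [a [b [ab ->]]] IJ x Jx; rewrite dual_arc //.
have no y : arc u v y -> ~ arc a b y.
  by move=> Iy Jy; have : (arc u v `&` arc a b) y by []; rewrite IJ.
have [xu|xv|/no//|//] := arc_cover x uv; exfalso.
- rewrite xu in Jx; have [y [_ [Jy uyv _ _]]] := arc_near Jx (nesym uv).
  exact: no Jy.
- rewrite xv in Jx; have [_ [z [_ _ Jz uzv]]] := arc_near Jx uv.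
  exact: no Jz.
Qed.

(** Some end of [M] is interior to [I], and the part of [I] beyond that end contains an arc. *)
Lemma infinite_arcD (R : realType) (I M : set (S1 R)) :
  open_interval I -> open_interval M -> M `<=` I -> M <> I ->
  infinite_set (I `\` M).
Proof.
move=> [u [v [uv ->]]] [s [t [st ->]]] sub neq.
have Mu : ~ arc s t u by move=> /sub/arcN_left.
have [su|su] := pselect (s = u).
- have tv : t <> v by move=> tv; apply: neq; rewrite su tv.
  have It : arc u v t.
    by apply: contrapT => nt; apply: tv; exact: (arc_right st sub nt).
  apply: (sub_infinite_set _ (infinite_arc tv)) => x tx; split.
  + move: It tx; rewrite /arc /= (ccw_angle u t) !(ccw_base u).
    by move=> -[? ?] [] [? ?]; split; order.
  + move: It tx; rewrite /arc /= su (ccw_angle u t) !(ccw_base u).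
    by move=> -[? ?] [] [? ?] [? ?]; order.
- have Is : arc u v s.
    by apply: contrapT => ns; apply: su; exact: (arc_left st sub ns).
  apply: (sub_infinite_set _ (infinite_arc (nesym su))) => x ux; split.
    exact: ccw_trans ux Is.
  move: ux Mu; rewrite /arc /= !(ccw_angle u s) !(ccw_base u) angle_self.
  move=> [? ?] Mu; case=> -[? ?]; try order.
  by apply: Mu; constructor 2; split; order.
Qed.

(** The four relative positions of two sides of noncrossing leaves; in the last one the two
    intervals cover the circle up to endpoints. *)
Lemma unlinked (R : realType) (L : set (set (S1 R))) (I J : set (S1 R)) :
  lamination_system L -> L I -> L J ->
  [\/ I `<=` J, J `<=` I, I `&` J = set0 | dual I `<=` J].
Proof.
move=> [_ Lo _ lies _] LI LJ.
have oI := Lo _ LI; have oJ := Lo _ LJ.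
have [[K [->|->] KJ]|[K [->|->] KJ]] := lies _ _ LI LJ.
- by constructor 1.
- by constructor 4.
- constructor 3; apply/seteqP; split=> // x [Ix Jx].
  exact: dual_disj Jx (KJ _ Ix).
- constructor 2; rewrite -(dualK oI) -(dualK oJ).
  by apply: dual_subset => //; exact: open_interval_dual.
Qed.

(** Requiring [J_ n <> I] rules out constant sequences, so the approximation is genuine. *)
Definition limit_of_leaves (R : realType) (L : set (set (S1 R)))
    (I : set (S1 R)) : Prop :=
  exists J_ : nat -> set (S1 R),
    [/\ forall n, L (J_ n), forall n, J_ n `<=` J_ n.+1,
        forall n, J_ n <> I & \bigcup_n J_ n = I].

Lemma limit_of_leaves_two_points (R : realType) (L : set (set (S1 R)))
    (I : set (S1 R)) (p q : S1 R) : limit_of_leaves L I -> I p -> I q ->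
  exists J, [/\ L J, J `<=` I, J <> I, J p & J q].
Proof.
move=> [J_ [LJ inc neq JI]]; rewrite -{1 2}JI => -[m _ Jp] [n _ Jq].
have mono i j : (i <= j)%N -> J_ i `<=` J_ j.
  move=> /subnK <-; elim: (j - i)%N => [//|k IH]; exact: subset_trans IH (inc _).
exists (J_ (maxn m n)); split=> //.
- by rewrite -JI => x; exists (maxn m n).
- by apply: mono Jp; exact: leq_maxl.
- by apply: mono Jq; exact: leq_maxr.
Qed.

Definition three_sided_gap (R : realType) (L : set (set (S1 R))) : Prop :=
  exists Gp I1 I2 I3, [/\ gap L Gp, Gp I1, Gp I2 & Gp I3] /\
    [/\ I1 <> I2, I1 <> I3 & I2 <> I3].

(* If [I] is not a limit, then [dual I] and the maximal leaves inside [I] form a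
   gap; with at most two sides it would have infinitely many vertices. *)
Lemma limit_of_leavesP (R : realType) (L : set (set (S1 R))) I :
  lamination_system L -> very_full L -> ~ three_sided_gap L -> L I ->
  limit_of_leaves L I.
Proof.
move=> lamL vf no3 LI; apply: contrapT => nlim.
have [_ Lo Ld lies Lc] := lamL.
have oI := Lo _ LI; have oI' := open_interval_dual oI.
have [u [v [uv IE]]] := oI.
pose F := [set J | [/\ L J, J `<=` I & J <> I]].
have notu J : F J -> ~ J u by move=> [_ JI _] /JI; rewrite IE => /arcN_left.
have notv J : F J -> ~ J v by move=> [_ JI _] /JI; rewrite IE => /arcN_right.
have sF J : F J -> segment u J.
  by move=> FJ; have [LJ _ _] := FJ; apply: open_interval_segment (notu _ FJ); exact: Lo.
have cF (J_ : nat -> set (S1 R)) : (forall n, F (J_ n)) ->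
    (forall n, J_ n `<=` J_ n.+1) -> F (\bigcup_n J_ n).
  move=> FJ inc.
  have UI : \bigcup_n J_ n `<=` I by move=> x [n _]; have [_ + _] := FJ n; apply.
  have LJ n : L (J_ n) by have [] := FJ n.
  split=> //.
    apply: Lc => //; apply: (open_interval_bigcup _ inc uv) => n.
    - exact/Lo/LJ.
    - exact/notu/FJ.
    - exact/notv/FJ.
  by move=> UE; apply: nlim; exists J_; split=> // n; have [] := FJ n.
pose Max := [set M | F M /\ forall K, F K -> M `<=` K -> K = M].
have disjd M x : F M -> M x -> ~ dual I x.
  by move=> [_ MI _] /MI; exact: dual_disj.
have gapM : gap L (dual I |` Max).
  split.
  - by move=> J [->|[[LJ _ _] _]] //; exact: Ld.
  - move=> A B [->|mA] [->|mB] // [x [/= Ax Bx]].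
    + by case: (disjd _ _ mB.1 Bx).
    + by case: (disjd _ _ mA.1 Ax).
    + have [[LA AI _] Amax] := mA; have [[LB BI _] Bmax] := mB.
      have [AB|BA|AB|AB] := unlinked lamL LA LB.
      * by rewrite (Amax _ mB.1 AB).
      * by rewrite (Bmax _ mA.1 BA).
      * by have : (A `&` B) x by []; rewrite AB.
      (* Here [dual I] would lie in [dual A], hence in [B], hence in [I]. *)
      * have [y Iy] := open_interval_nonempty oI'; exfalso.
        apply: (dual_disj _ Iy); apply/BI/AB.
        exact: (dual_subset (Lo _ LA) oI AI).
  - move=> K LK; have oK := Lo _ LK.
    have [[K' lK' K'I]|KI] := lies _ _ LK LI; last by exists (dual I) => //; left.
    have LK' : L K' by case: lK' => ->; [|exact: Ld].
    have [K'e|K'n] := pselect (K' = I).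
      exists (dual I); first by left.
      exists (dual K'); last by rewrite K'e.
      by case: lK' => ->; [right|left; exact: dualK].
    have FK' : F K' by [].
    have [M [FM K'M Mmax]] := maximal_interval sF cF FK'.
    by exists M; [right|exists K'].
have fin := vf _ gapM.
have inf : infinite_set (vertices (dual I |` Max)); last by apply: inf.
(* Two maximal leaves would give, with [dual I], a third side. With a single one [M] the vertices
   contain [I] minus [M], and with none they contain [I]. *)
have [[M mM]|noM] := pselect (exists M, Max M).
- have uniqM M' : Max M' -> M' = M.
    move=> mM'; apply: contrapT => M'M; apply: no3.
    have dM N : Max N -> dual I <> N.
      move=> mN dN; have [LN _ _] := mN.1.
      have [x Nx] := open_interval_nonempty (Lo _ LN).
      by apply: (disjd _ _ mN.1 Nx); rewrite dN.
    exists (dual I |` Max), (dual I), M, M'; split; split => //.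
    + by left.
    + by right.
    + by right.
    + exact: dM.
    + exact: dM.
    + exact: nesym.
  have [[LM MI MneI] _] := mM.
  apply: sub_infinite_set (infinite_arcD oI (Lo _ LM) MI MneI) => x [Ix Mx].
  by move=> [J [->|/uniqM ->]] //=; exact: dual_disj.
- apply: (@sub_infinite_set _ I); last by rewrite IE; exact: infinite_arc.
  move=> x Ix [J [->|mJ]] /=; first exact: dual_disj.
  by case: noM; exists J.
Qed.

(** * Groups of circle homeomorphisms *)

Lemma homeo_inj (R : realType) (f : S1 R -> S1 R) : homeo_plus f -> injective f.
Proof. by move=> [_ [g [_ fK _]] _]; exact: can_inj fK. Qed.

Lemma homeo_ccw (R : realType) (f : S1 R -> S1 R) a b c :
  homeo_plus f -> ccw (f a) (f b) (f c) <-> ccw a b c.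
Proof.
move=> hf; have finj := homeo_inj hf; have [_ _ fccw] := hf.
split=> [fabc|]; last exact: fccw.
have [ab bc ac] := ccw_neq fabc.
have [//|acb] := @ccw_total _ a b c (fun e => ab (congr1 f e))
  (fun e => bc (congr1 f e)) (fun e => ac (congr1 f e)).
by case: (ccw_asym fabc (fccw _ _ _ acb)).
Qed.

Lemma homeo_arc (R : realType) (f : S1 R -> S1 R) u v :
  homeo_plus f -> f @` arc u v = arc (f u) (f v).
Proof.
move=> hf; apply/seteqP; split=> [_ [x ux <-]|x fx]; first exact/homeo_ccw.
have [_ [g [_ _ gK]] _] := hf.
by exists (g x); rewrite ?gK // /arc /= -(homeo_ccw _ _ _ hf) gK.
Qed.

Lemma homeo_dual (R : realType) (f : S1 R -> S1 R) I :
  homeo_plus f -> open_interval I -> dual (f @` I) = f @` dual I.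
Proof.
move=> hf [u [v [uv ->]]]; rewrite dual_arc // !homeo_arc // dual_arc //.
by move/(homeo_inj hf).
Qed.

Lemma subgroup_inverse (R : realType) (G : set (S1 R -> S1 R)) g :
  homeo_subgroup G -> G g -> exists g', [/\ G g', cancel g g' & cancel g' g].
Proof.
move=> [hG _ _ Ginv] Gg; have [_ [g' [_ gK g'K]] _] := hG _ Gg.
by exists g'; split=> //; exact: Ginv gK g'K.
Qed.

(** Singletons are compact, so a condition on one value is open in the compact-open topology. *)
Lemma eval_nbhs (T U : topologicalType) (f : T -> U) (x : T) (O : set U) :
  open O -> O (f x) -> nbhs (f : {compact-open, T -> U}) [set h | O (h x)].
Proof.
move=> oO Ofx; apply: open_nbhs_nbhs; split=> //.
have := compact_open_open (@compact_set1 _ x) oO.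
congr open; apply/seteqP; split=> h /=; first by apply; exists x.
by move=> Ohx _ [_ -> <-].
Qed.

(** * Discreteness from a gap with three sides *)

Lemma gap_disjoint (R : realType) (L Gp : set (set (S1 R))) I J x :
  gap L Gp -> Gp I -> Gp J -> I x -> J x -> I = J.
Proof. by move=> [_ triv _] GI GJ Ix Jx; apply: (triv _ _ GI GJ); exists x. Qed.

(** The image leaf lies on some side [J]. If the image of [I1] is inside [J], the point [k p1] gives
    [J = I1]. If its dual is, [J] contains [k p2] and [k p3], which forces [I2 = I3]; this is where
    a third side matters. *)
Lemma gap_side_stable (R : realType) (L Gp : set (set (S1 R))) I1 I2 I3 p1 p2 p3
    (k : S1 R -> S1 R) :
  lamination_system L -> gap L Gp -> Gp I1 -> Gp I2 -> Gp I3 ->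
  I1 <> I2 -> I1 <> I3 -> I2 <> I3 -> I1 p1 -> I2 p2 -> I3 p3 ->
  homeo_plus k -> L (k @` I1) -> I1 (k p1) -> I2 (k p2) -> I3 (k p3) ->
  k @` I1 `<=` I1.
Proof.
move=> [_ Lo _ _ _] gp G1 G2 G3 n12 n13 n23 Ip1 Ip2 Ip3 hk Lk k1 k2 k3.
have [GL _ lies] := gp; have oI J : Gp J -> open_interval J by move=> /GL/Lo.
have in_dual J p : Gp J -> I1 <> J -> J p -> dual I1 p.
  move=> GJ neq; apply: disjoint_dual (oI _ G1) (oI _ GJ) _ _.
  apply/seteqP; split=> // x [I1x Jx].
  by apply: neq; exact: gap_disjoint gp G1 GJ I1x Jx.
have [J GJ [K [->|->] KJ]] := lies _ Lk.
- by rewrite {2}(gap_disjoint gp G1 GJ k1 (KJ _ _)) //; exists p1.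
- rewrite homeo_dual // in KJ; last exact: oI.
  case: n23; transitivity J.
  + apply: (gap_disjoint gp G2 GJ k2); apply: KJ; exists p2 => //.
    exact: in_dual Ip2.
  + apply: (gap_disjoint gp GJ G3 _ k3); apply: KJ; exists p3 => //.
    exact: in_dual Ip3.
Qed.

(** Controls the inverse of f^-1 h without continuity of inversion: with x, y, z in order in [I], if
    f^-1 h keeps x before y and z after y, its inverse sends y between x and z. *)
Lemma interval_neighbourhood (R : realType) (f f' : S1 R -> S1 R)
    (I : set (S1 R)) :
  homeo_plus f -> cancel f f' -> open_interval I ->
  exists p V, [/\ I p, nbhs (f : {compact-open, S1 R -> S1 R}) V &
    forall h, V h -> I (f' (h p)) /\
      (forall k', homeo_plus (f' \o h) -> cancel k' (f' \o h) -> I (k' p))].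
Proof.
move=> hf fK [u [v [uv ->]]].
have [y uyv] := arc_nonempty uv; have [uy yv _] := ccw_neq uyv.
have [x uxy] := arc_nonempty uy; have [z yzv] := arc_nonempty yv.
have at_nbhs a b w : arc a b w ->
    nbhs (f : {compact-open, S1 R -> S1 R}) [set h | arc (f a) (f b) (h w)].
  move=> abw; apply: (eval_nbhs (open_arc _ _)).
  by rewrite -homeo_arc //; exists w.
have back a b w : arc (f a) (f b) w -> arc a b (f' w).
  by rewrite -homeo_arc // => -[c abc <-]; rewrite fK.
exists y, ([set h | arc (f u) (f y) (h x)] `&` ([set h | arc (f u) (f v) (h y)]
  `&` [set h | arc (f y) (f v) (h z)])); split=> //.
  by apply: filterI; [exact: at_nbhs|apply: filterI; exact: at_nbhs].
move=> h [/= /back hx [/back hy /back hz]]; split=> // k' hk kK.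
have : ccw x (k' y) z.
  rewrite -(homeo_ccw _ _ _ hk) kK /=; move: hx hz uyv; rewrite /arc /=.
  rewrite (ccw_angle u y) (ccw_angle u (f' (h x))) !(ccw_base u).
  by move=> [? ?] [] [? ?] [? ?]; constructor 1; split; order.
move: uxy yzv uyv; rewrite /arc /=.
rewrite (ccw_angle u y) (ccw_angle u x) !(ccw_base u).
by move=> [? ?] [] [? ?] [? ?] [] [? ?]; split; order.
Qed.

(** Two points bound only two arcs, dual to each other. *)
Lemma three_endpoints (R : realType) (P : set (S1 R)) u1 v1 u2 v2 u3 v3 :
  u1 <> v1 -> u2 <> v2 -> u3 <> v3 ->
  arc u1 v1 <> arc u2 v2 -> arc u1 v1 <> arc u3 v3 -> arc u2 v2 <> arc u3 v3 ->
  P u1 -> P v1 -> P u2 -> P v2 -> P u3 -> P v3 ->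
  exists a b c, [/\ P a, P b & P c] /\ [/\ a <> b, a <> c & b <> c].
Proof.
move=> n1 n2 n3 n12 n13 n23 Pu1 Pv1 Pu2 Pv2 Pu3 Pv3.
apply: contrapT => none.
have two w : P w -> w = u1 \/ w = v1.
  move=> Pw; apply: contrapT => /not_orP[wu wv]; apply: none.
  by exists w, u1, v1.
have flip u v : P u -> P v -> u <> v -> arc u1 v1 <> arc u v -> u = v1 /\ v = u1.
  move=> /two[->|->] /two[->|->] //.
by have [u2E v2E] := flip _ _ Pu2 Pv2 n2 n12;
   have [u3E v3E] := flip _ _ Pu3 Pv3 n3 n13;
   apply: n23; rewrite u2E v2E u3E v3E.
Qed.

Lemma three_sided_gap_discrete (R : realType) (G : set (S1 R -> S1 R)) L :
  homeo_subgroup G -> mobius_like G -> lamination_system L ->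
  invariant_system G L -> three_sided_gap L -> discrete_subgroup G.
Proof.
move=> sG mG lamL inv [Gp [I1 [I2 [I3 [[gp G1 G2 G3] [n12 n13 n23]]]]]].
have [hG Gid Gcomp _] := sG; split=> // f Gf; split; first exact: mem_set.
have [GL _ _] := gp; have [_ Lo _ _ _] := lamL.
have oI J : Gp J -> open_interval J by move=> /GL/Lo.
have [f' [Gf' fK f'K]] := subgroup_inverse sG Gf; have hf := hG _ Gf.
have [p1 [V1 [Ip1 nV1 V1P]]] := interval_neighbourhood hf fK (oI _ G1).
have [p2 [V2 [Ip2 nV2 V2P]]] := interval_neighbourhood hf fK (oI _ G2).
have [p3 [V3 [Ip3 nV3 V3P]]] := interval_neighbourhood hf fK (oI _ G3).
exists (V1 `&` (V2 `&` V3)); first by do 2![apply: filterI => //].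
apply/seteqP; split=> [h [[V1h [V2h V3h]] Gh]|_ ->]; last first.
  by split=> //; split; [exact: nbhs_singleton nV1|];
    split; [exact: nbhs_singleton nV2|exact: nbhs_singleton nV3].
pose k := f' \o h; have Gk : G k by exact: Gcomp.
have hk := hG _ Gk; have [k' [Gk' kK k'K]] := subgroup_inverse sG Gk.
have hk' := hG _ Gk'.
have [a1 /(_ k' hk k'K) b1] := V1P _ V1h.
have [a2 /(_ k' hk k'K) b2] := V2P _ V2h.
have [a3 /(_ k' hk k'K) b3] := V3P _ V3h.
(* A strict inclusion would not fix the ends of a side; the inverse supplies the reverse
   inclusion. *)
have stable J : k @` J `<=` J -> k' @` J `<=` J -> k @` J = J.
  move=> kJ k'J; apply/seteqP; split=> // x Jx; exists (k' x) => //.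
  by apply: k'J; exists x.
have side g : G g -> homeo_plus g -> I1 (g p1) -> I2 (g p2) -> I3 (g p3) ->
    [/\ g @` I1 `<=` I1, g @` I2 `<=` I2 & g @` I3 `<=` I3].
  move=> Gg hg g1 g2 g3; split.
  - apply: (gap_side_stable lamL gp G1 G2 G3 _ _ _ Ip1 Ip2 Ip3) => //.
    exact/inv/GL.
  - apply: (gap_side_stable lamL gp G2 G1 G3 _ _ _ Ip2 Ip1 Ip3) => //.
      exact: nesym.
    exact/inv/GL.
  - apply: (gap_side_stable lamL gp G3 G1 G2 _ _ _ Ip3 Ip1 Ip2) => //.
    + exact: nesym.
    + exact: nesym.
    exact/inv/GL.
have [k1 k2 k3] := side k Gk hk a1 a2 a3.
have [k'1 k'2 k'3] := side k' Gk' hk' b1 b2 b3.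
have ends u v : u <> v -> k @` arc u v = arc u v -> k u = u /\ k v = v.
  move=> uv; rewrite homeo_arc // => /esym e.
  by have [<- <-] := arc_inj uv e.
have [u1 [v1 [uv1 E1]]] := oI _ G1; have [u2 [v2 [uv2 E2]]] := oI _ G2.
have [u3 [v3 [uv3 E3]]] := oI _ G3.
move: (stable _ k1 k'1) (stable _ k2 k'2) (stable _ k3 k'3) n12 n13 n23.
rewrite E1 E2 E3 => /(ends _ _ uv1)[ku1 kv1] /(ends _ _ uv2)[ku2 kv2].
move=> /(ends _ _ uv3)[ku3 kv3] n12 n13 n23.
have [a [b [c [[ka kb kc] [ab ac bc]]]]] :=
  @three_endpoints _ [set x | k x = x] _ _ _ _ _ _ uv1 uv2 uv3 n12 n13 n23
    ku1 kv1 ku2 kv2 ku3 kv3.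
have k_id := mobius_like_three_fixed mG Gk ab ac bc ka kb kc.
by apply/funext => x; rewrite -[LHS]f'K; congr f; exact: (congr1 (@^~ x) k_id).
Qed.

(** * Endpoints and cusps *)

Lemma arc_endpoints (R : realType) (L : set (set (S1 R))) p :
  lamination_system L -> endpoints L p -> exists2 q, p <> q & L (arc p q).
Proof.
move=> [_ Lo Ld _ _] [I LI pI]; have [u [v [uv IE]]] := Lo _ LI.
have [pu|pv|up|vp] := arc_cover p uv.
- by exists v; rewrite pu // -IE.
- by exists u; rewrite pv; [exact: nesym|rewrite -dual_arc // -IE; exact: Ld].
- by case: pI; exists I; [left|rewrite IE].
- by case: pI; exists (dual I); [right|rewrite IE dual_arc].
Qed.

(** Enlarge [dual I] to a maximal [D] missing both points. If neither is an endpoint, both lie in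
    [dual D], hence in a smaller leaf interval inside it, whose dual contradicts the maximality of
    [D]. *)
Lemma two_points_endpoint (R : realType) (L : set (set (S1 R))) I p p' :
  lamination_system L -> (forall J, L J -> limit_of_leaves L J) ->
  L I -> I p -> I p' -> p <> p' -> endpoints L p \/ endpoints L p'.
Proof.
move=> lamL lim LI Ip Ip' pp'; apply: contrapT => /not_orP[Np Np'].
have [_ Lo Ld _ Lc] := lamL; have oI := Lo _ LI.
have side J y : ~ endpoints L y -> L J -> ~ J y -> dual J y.
  move=> Ny LJ NJy; apply: contrapT => NdJy; apply: Ny; exists J => //.
  by move=> [K [->|->]].
pose F := [set D | [/\ L D, dual I `<=` D, ~ D p & ~ D p']].
have sF D : F D -> segment p D.
  by move=> [/Lo oD _ Dp _]; exact: open_interval_segment.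
have cF (D_ : nat -> set (S1 R)) : (forall n, F (D_ n)) ->
    (forall n, D_ n `<=` D_ n.+1) -> F (\bigcup_n D_ n).
  move=> FD inc; have LD n : L (D_ n) by have [] := FD n.
  have Dp n : ~ D_ n p by have [] := FD n.
  have Dp' n : ~ D_ n p' by have [] := FD n.
  split.
  - apply: Lc => //; apply: (open_interval_bigcup _ inc pp') => // n.
    exact/Lo/LD.
  - by move=> y Iy; exists 0%N => //; have [_ + _ _] := FD 0%N; apply.
  - by move=> [n _ /Dp].
  - by move=> [n _ /Dp'].
have FI : F (dual I) by split=> //; [exact: Ld|exact: dual_disj|exact: dual_disj].
have [D [[LD ID Dp Dp'] _ Dmax]] := maximal_interval sF cF FI.
have [J [LJ JD Jne Jp Jp']] := limit_of_leaves_two_points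
  (lim _ (Ld _ LD)) (side _ _ Np LD Dp) (side _ _ Np' LD Dp').
have oD := Lo _ LD; have oJ := Lo _ LJ.
have DJ : D `<=` dual J.
  by rewrite -(dualK oD); apply: dual_subset => //; exact: open_interval_dual.
apply: Jne; rewrite -(dualK oJ); congr dual; apply: Dmax => //; split.
- exact: Ld.
- exact: subset_trans DJ.
- exact: dual_disj.
- exact: dual_disj.
Qed.

(** Each leaf interval contains at most one point that is not an endpoint, and the two sides of a
    single leaf cover all such points. *)
Lemma finite_nonendpoints (R : realType) (L : set (set (S1 R))) :
  lamination_system L -> (forall J, L J -> limit_of_leaves L J) ->
  finite_set (~` endpoints L).
Proof.
move=> lamL lim; have [[I LI] Lo Ld _ _] := lamL.
have fin J : L J -> finite_set (J `&` ~` endpoints L).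
  move=> LJ; have [[y [Jy Ny]]|none] := pselect (J `&` ~` endpoints L !=set0).
    apply: (@sub_finite_set _ _ [set y]) => // x [Jx Nx].
    apply: contrapT => xy.
    by case: (two_points_endpoint lamL lim LJ Jx Jy xy).
  apply: (@sub_finite_set _ _ set0) => // x Jx.
  by apply: none; exists x.
have : finite_set ((I `&` ~` endpoints L) `|` (dual I `&` ~` endpoints L)).
  by rewrite finite_setU; split; apply: fin => //; exact: Ld.
apply: sub_finite_set => x Nx.
have [Ix|NIx] := pselect (I x); first by left.
have [dx|Ndx] := pselect (dual I x); first by right.
by case: Nx; exists I => // -[K [->|->]].
Qed.

(** * Dynamics at a cusp *)

(** If [x] were missed, the union would be an interval preserved by [f], and its two distinct ends
    would both be fixed. *)
Lemma expanding_arcs_cover (R : realType) (f : S1 R -> S1 R) p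
    (A_ : nat -> set (S1 R)) x :
  homeo_plus f -> (forall y, f y = y -> y = p) ->
  (forall n, open_interval (A_ n)) -> (forall n, A_ n `<=` A_ n.+1) ->
  (forall n, ~ A_ n p) -> (forall n, f @` A_ n = A_ n.+1) -> x <> p ->
  exists n, A_ n x.
Proof.
move=> hf fix_p oA inc Ap fA xp; apply: contrapT => none.
have [u [v [uv UE]]] : open_interval (\bigcup_n A_ n).
  by apply: (open_interval_bigcup oA inc (nesym xp)) => // n Ax; apply: none; exists n.
have fU : f @` (\bigcup_n A_ n) = \bigcup_n A_ n.
  apply/seteqP; split=> [_ [y [n _ Ay] <-]|y [n _ /inc]].
    by exists n.+1 => //; rewrite -fA; exists y.
  by rewrite -fA => -[z Az <-]; exists z => //; exists n.
move: fU; rewrite UE homeo_arc // => /esym/(arc_inj uv)[/esym fu /esym fv].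
by apply: uv; rewrite (fix_p _ fu) (fix_p _ fv).
Qed.

Lemma iter_ccw_out (R : realType) (f : S1 R -> S1 R) p q x :
  homeo_plus f -> f p = p -> (forall y, f y = y -> y = p) ->
  ccw p q (f q) -> x <> p -> exists n, ccw p x (iter n f q).
Proof.
move=> hf fp fix_p pq xp.
have step n : ccw p (iter n f q) (iter n.+1 f q).
  elim: n => // n; rewrite -(homeo_ccw _ _ _ hf) fp //.
apply: (@expanding_arcs_cover _ f p (fun n => arc p (iter n f q))) => // n.
- by exists p, (iter n f q); split=> //; have [] := ccw_neq (step n).
- by move=> y py; exact: ccw_trans py (step n).
- exact: arcN_left.
- by rewrite homeo_arc // fp.
Qed.

Lemma iter_ccw_in (R : realType) (f : S1 R -> S1 R) p q x :
  homeo_plus f -> f p = p -> (forall y, f y = y -> y = p) ->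
  ccw p (f q) q -> x <> p -> exists n, ccw p (iter n f q) x.
Proof.
move=> hf fp fix_p pq xp.
have step n : ccw p (iter n.+1 f q) (iter n f q).
  elim: n => // n; rewrite -(homeo_ccw _ _ _ hf) fp //.
have [n nx] : exists n, arc (iter n f q) p x; last first.
  by exists n; exact/ccw_rot/ccw_rot.
apply: (@expanding_arcs_cover _ f p (fun n => arc (iter n f q) p)) => // n.
- exists (iter n f q), p; split=> //.
  by have [_ _ /nesym] := ccw_neq (step n).
- move=> y /ccw_rot/ccw_rot py; apply/ccw_rot.
  exact: ccw_trans (step n) py.
- exact: arcN_right.
- by rewrite homeo_arc // fp.
Qed.

(** [g] and its inverse push [q] in opposite directions around the circle, so their orbits approach
    [p] from both sides and carry the leaf along. *)
Lemma parabolic_leaves (R : realType) (G : set (S1 R -> S1 R)) L g p q x :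
  homeo_subgroup G -> invariant_system G L -> G g -> g p = p ->
  (forall y, g y = y -> y = p) -> p <> q -> L (arc p q) -> x <> p ->
  (exists2 m, L (arc p m) & ccw p x m) /\ (exists2 m, L (arc p m) & ccw p m x).
Proof.
move=> sG inv Gg gp fix_p pq Lpq xp; have [hG _ _ _] := sG.
have hg := hG _ Gg; have [g' [Gg' gK g'K]] := subgroup_inverse sG Gg.
have hg' := hG _ Gg'; have g'p : g' p = p by rewrite -{1}gp gK.
have fix_p' y : g' y = y -> y = p by move=> y'; apply: fix_p; rewrite -{1}y' g'K.
have orbit f n : G f -> f p = p -> L (arc p (iter n f q)).
  move=> Gf fp; elim: n => //= n IH; rewrite -{1}fp -homeo_arc; last exact: hG.
  exact: inv.
have gq : p <> g q by move=> e; apply: pq; rewrite -[LHS]g'p e gK.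
have qgq : q <> g q by move=> /esym/fix_p/esym.
have [out|inn] := ccw_total pq qgq gq.
- have inn : ccw p (g' q) q.
    by rewrite -(homeo_ccw _ _ _ hg) gp g'K.
  have [n nx] := iter_ccw_out hg gp fix_p out xp.
  have [m mx] := iter_ccw_in hg' g'p fix_p' inn xp.
  by split; [exists (iter n g q)|exists (iter m g' q)] => //; exact: orbit.
- have out : ccw p q (g' q).
    by rewrite -(homeo_ccw _ _ _ hg) gp g'K.
  have [n nx] := iter_ccw_out hg' g'p fix_p' out xp.
  have [m mx] := iter_ccw_in hg gp fix_p inn xp.
  by split; [exists (iter n g' q)|exists (iter m g q)] => //; exact: orbit.
Qed.

(* Take the largest leaf of the form [arc y p] avoiding [x]; if [y <> x], the leaves
   approximating its dual end at [p] as well, since they cannot cross the leaves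
   [arc p m] with [m] close to [p], and their duals are larger. *)
Lemma parabolic_fan (R : realType) (G : set (S1 R -> S1 R)) L g p q x :
  homeo_subgroup G -> lamination_system L -> invariant_system G L ->
  (forall J, L J -> limit_of_leaves L J) -> G g -> g p = p ->
  (forall y, g y = y -> y = p) -> p <> q -> L (arc p q) -> x <> p ->
  L (arc p x).
Proof.
move=> sG lamL inv lim Gg gp fix_p pq Lpq xp; have [_ Lo Ld _ Lc] := lamL.
have [[m Lm pxm] [m' Lm' pm'x]] := parabolic_leaves sG inv Gg gp fix_p pq Lpq xp.
have [_ xm pm] := ccw_neq pxm; have [pm' m'x px] := ccw_neq pm'x.
have Lmp : L (arc m p) by rewrite -dual_arc //; exact: Ld.
pose F := [set K | [/\ L K, arc m p `<=` K, ~ K p & ~ K x]].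
have sF K : F K -> segment p K.
  by move=> [/Lo oK _ Kp _]; exact: open_interval_segment.
have cF (K_ : nat -> set (S1 R)) : (forall n, F (K_ n)) ->
    (forall n, K_ n `<=` K_ n.+1) -> F (\bigcup_n K_ n).
  move=> FK inc; have LK n : L (K_ n) by have [] := FK n.
  have Kp n : ~ K_ n p by have [] := FK n.
  have Kx n : ~ K_ n x by have [] := FK n.
  split.
  - apply: Lc => //; apply: (open_interval_bigcup _ inc px) => // n.
    exact/Lo/LK.
  - by move=> y Iy; exists 0%N => //; have [_ + _ _] := FK 0%N; apply.
  - by move=> [n _ /Kp].
  - by move=> [n _ /Kx].
have Fm : F (arc m p).
  split=> //; first exact: arcN_right.
  by move=> /ccw_rot/ccw_rot; exact: ccw_asym.
have [K [[LK mK Kp Kx] _ Kmax]] := maximal_interval sF cF Fm.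
have oK := Lo _ LK; have [u [v [uv KE]]] := oK.
have vp : p = v.
  by rewrite KE in mK Kp; exact: arc_right (nesym pm) mK Kp.
subst v; have [<-|ux] := pselect (u = x).
  by rewrite -dual_arc // -KE; exact: Ld.
have dKE : dual K = arc p u by rewrite KE dual_arc.
have dKx : dual K x.
  rewrite dKE; have [//|h] := ccw_total px (nesym ux) (nesym uv).
  by case: Kx; rewrite KE; exact: ccw_rot.
have dKm' : dual K m' by rewrite dKE in dKx *; exact: ccw_trans pm'x dKx.
have [J [LJ JK Jne Jx Jm']] := limit_of_leaves_two_points (lim _ (Ld _ LK)) dKx dKm'.
have oJ := Lo _ LJ.
have KJ : K `<=` dual J.
  by rewrite -(dualK oK); apply: dual_subset => //; exact: open_interval_dual.
have Kne : dual J <> K by move=> e; apply: Jne; rewrite -e dualK.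
exfalso; apply: Kne; apply: Kmax => //; split.
- exact: Ld.
- exact: subset_trans KJ.
(* The leaf [arc p m'] keeps [p] out of [dual J]: [J] contains [m'] and, beyond it, [x], while [K],
   which lies in [dual J], comes after [x]. Each relative position then contradicts one of these
   facts or [p] being in [dual J]. *)
- have [a [b [ab JE]]] := oJ.
  have [Jm|mJ|dis|dJ] := unlinked lamL LJ Lm'.
  + by have := ccw_asym pm'x (Jm _ Jx).
  + have dJE : dual J = arc b a by rewrite JE dual_arc.
    rewrite dJE => dJp.
    have [y [_ [by_ py _ _]]] := arc_near dJp (nesym pm').
    by apply: (dual_disj (mJ _ py)); rewrite dJE.
  + rewrite JE in Jm' dis.
    have [_ [z [_ _ az pz]]] := arc_near Jm' pm'.
    by have : (arc a b `&` arc p m') z by []; rewrite dis.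
  + have [y Ky] := open_interval_nonempty oK.
    have upy : ccw u y p by rewrite KE in Ky.
    have pmy := dJ _ (KJ _ Ky); have puy := ccw_rot (ccw_rot upy).
    have pxu : ccw p x u by rewrite dKE in dKx.
    have h := ccw_trans (ccw_trans pm'x pxu) puy.
    by case: (ccw_asym h pmy).
- exact: dual_disj.
Qed.

Theorem corollary3p7 (R : realType) (G : set (S1 R -> S1 R))
    (L1 L2 : set (set (S1 R))) :
  pants_like_COL 2 G ->
  L1 <> L2 ->
  pants_like G [set L1; L2] ->
  mobius_like G ->
  discrete_subgroup G.
Proof.
move=> [sG _] L12 [sys trans cusps] mG.
have C1 : [set L1; L2] L1 by left.
have C2 : [set L1; L2] L2 by right.
have [lam1 inv1 vf1] := sys _ C1; have [lam2 inv2 vf2] := sys _ C2.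
have [gap1|no1] := pselect (three_sided_gap L1).
  exact: three_sided_gap_discrete gap1.
have [gap2|no2] := pselect (three_sided_gap L2).
  exact: three_sided_gap_discrete gap2.
have lim1 J := limit_of_leavesP (I := J) lam1 vf1 no1.
have lim2 J := limit_of_leavesP (I := J) lam2 vf2 no2.
exfalso.
have [p [p1 p2]] : endpoints L1 `&` endpoints L2 !=set0.
  apply/set0P/negP => /eqP E0; have [[I LI] Lo _ _ _] := lam1.
  have [u [v [uv _]]] := Lo _ LI; apply: (infinite_arc uv).
  (* Without a common endpoint these two finite sets would cover the circle, which contains an
     infinite arc. *)
  have : finite_set (~` endpoints L1 `|` ~` endpoints L2).
    by rewrite finite_setU; split; exact: finite_nonendpoints.
  by apply: sub_finite_set => x _; rewrite -setCI E0.
have [g [Gg [_ _ [z [gz uz]]] gp]] := cusps _ _ C1 C2 L12 _ (conj p1 p2).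
have fix_p y : g y = y -> y = p by move=> /uz <-; rewrite (uz _ gp).
have [q pq Lq] := arc_endpoints lam1 p1.
have [q' pq' Lq'] := arc_endpoints lam2 p2.
(* The fan of [L2] at [p] reaches every other point, in particular the far end [q] of a leaf of
   [L1]. *)
have L2q := parabolic_fan sG lam2 inv2 lim2 Gg gp fix_p pq' Lq' (nesym pq).
have : (L1 `&` L2) (arc p q) by [].
by rewrite (trans _ _ C1 C2 L12).
Qed.
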